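(* Let $\mathbf{k}$ be a field of characteristic $0$, $N\ge1$, $\pi$ an arbitrary $(N,N)$-shuffle, and let $F_\pi(s)=\sum_{\lambda\in\mathbb{Z}^{2N}}c^\pi_\lambda s^\lambda$ be the generating series for the Euler characteristics $c^\pi_\lambda=\chi(H^\bullet(\mathfrak{n}_\pi,\mathbf{k})_\lambda)$ of the $\lambda$-isotypic components of $H^\bullet(\mathfrak{n}_\pi,\mathbf{k})$ under the torus $T=\mathbb{G}_m^{2N}$. Then: (a) For every $\lambda\in\mathbb{Z}^{2N}$, $$c^\pi_\lambda=\sum_{\phi\in S}I^\pi_\phi\bigl(\lambda-\delta^{\pi_1}+\delta^\pi\bigr),$$ where $\pi_1$ is the $(N,N)$-shuffle that arranges the indices in the order $1,N+1,2,N+2,\dots,N,2N$, i.e. $\pi_1(i)=2i-1$ and $\pi_1(N+i)=2i$ for $1\le i\le N$. (b) The sum on the right-hand side of (a) is always equal to $0$ or $\pm1$.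
   Context: An $(N,N)$-shuffle is a permutation $\pi\in S_{2N}$ increasing on $\{1,\dots,N\}$ and on $\{N+1,\dots,2N\}$. Let $\mathbf{k}^{N|N}$ have coordinate lines $\mathbf{k}_1,\dots,\mathbf{k}_{2N}$, with $\mathbf{k}_1,\dots,\mathbf{k}_N$ even and $\mathbf{k}_{N+1},\dots,\mathbf{k}_{2N}$ odd, and let $\mathfrak{n}_\pi=\bigoplus_{\pi(i)<\pi(j)}\mathrm{Hom}(\mathbf{k}_i,\mathbf{k}_j)\subset\mathfrak{gl}(N|N)$ (the nilpotent radical of the Borel subalgebra $\mathfrak{b}_\pi$), a Lie superalgebra under the supercommutator. The torus $T=\mathbb{G}_m^{2N}$ with coordinates $s=(s_1,\dots,s_{2N})$ scales $\mathbf{k}_i$ by $s_i$, so $\mathrm{Hom}(\mathbf{k}_i,\mathbf{k}_j)$ has character $s_j/s_i$ and the corresponding generator of the cochain complex has character $s_i/s_j$. The cochain algebra is $C^\bullet(\mathfrak{n}_\pi,\mathbf k)=S^\bullet(\mathfrak{n}_\pi^*[-1])$ (polynomial on duals of odd elements, exterior on duals of even elements), and Euler characteristics are taken with respect to total parity (cochain degree plus internal parity), so that generators dual to odd elements are even and generators dual to even elements are odd. Let $e_1,\dots,e_{2N}$ be the standard basis of $\mathbb{Z}^{2N}$ and $\alpha_{ij}=e_i-e_j$. Put $$\delta^\pi=\sum_{i\le N<j,\ \pi(j)<\pi(i)}\alpha_{ji}.$$ Let $S$ be the set of bijections $\phi:\{1,\dots,N\}\to\{N+1,\dots,2N\}$.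 Number $N(\phi,\pi)$: take $2N$ points $a_1,\dots,a_{2N}$ on the unit circle in $\mathbb{R}^2$, in clockwise order but otherwise in general position; for each $i=1,\dots,N$ join $a_{\pi(i)}$ to $a_{\pi(\phi(i))}$ by a straight line segment; $N(\phi,\pi)$ is the number of pairwise intersection points of these segments. Sector $\mathfrak{S}(\phi,\pi)\subset\mathbb{Z}^{2N}$: the set of integral linear combinations $$\sum_{i\in\{1,\dots,N\},\ \pi(i)<\pi(\phi(i))}a_i\,\alpha_{i,\phi(i)}+\sum_{i\in\{1,\dots,N\},\ \pi(i)>\pi(\phi(i))}b_i\,\alpha_{i,\phi(i)},\qquad a_i\ge0,\ b_i<0.$$ Finally $I^\pi_\phi(\lambda)=(-1)^{N(\phi,\pi)}$ if $\lambda\in\mathfrak{S}(\phi,\pi)$, and $I^\pi_\phi(\lambda)=0$ otherwise. *)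

(* Defs.v *)
From HB Require Import structures.
From mathcomp Require Import all_boot all_order all_algebra all_fingroup.
From mathcomp Require Import finmap boolp classical_sets functions cardinality.
From mathcomp Require Import reals trigo.

Set Implicit Arguments.
Unset Strict Implicit.
Unset Printing Implicit Defensive.

Import Order.TTheory GRing.Theory Num.Theory.

Local Open Scope ring_scope.

(* [n] is a Lie superalgebra with homogeneous basis [(e_r)], [r : I]; [par r] is
  the parity of [e_r] and [c r s t] the coefficient of [e_t] in the
  supercommutator [[e_r, e_s]].  The cochain algebra S(n^*[-1]) is the free
  supercommutative algebra on generators [x_r] dual to [e_r], of total parity
  [~~ par r]: it is polynomial in the [x_r] with [par r], and exterior in the
  others.  [wt r] is the weight of [x_r]. *)

Section Cochains.

Variables (k : fieldType) (I : finType) (par : I -> bool).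
Variables (c : I -> I -> I -> k) (n : nat) (wt : I -> 'rV[int]_n).

Implicit Types (r s t : I) (u : {ffun I -> nat}).

(* A basis of the cochain algebra: x^u := prod_r x_r ^ u(r), the factors being
   in increasing order of [enum_rank r], for [u] such that: *)
Definition admissible u := [forall r, par r || (u r <= 1)%N].

Definition degree u : nat := \sum_r u r.
Definition parity u : bool := odd (\sum_(r | par r) u r).
Definition weight u : 'rV[int]_n := \sum_r wt r *+ u r.

Definition incr r u : {ffun I -> nat} := [ffun s => (u s + (s == r))%N].
Definition decr r u : {ffun I -> nat} := [ffun s => (u s - (s == r))%N].

(* The Koszul sign for moving x_r past the factors of x^u preceding it. *)
Definition koszul r u : k :=
  if par r then 1 else
  (-1) ^+ (\sum_(s | ~~ par s && (enum_rank s < enum_rank r)%N) u s)%N.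

(* A formal cochain is given by its coefficients: [f u] is that of x^u.
   The next two are left multiplication by x_r, and the left superderivation
   d/dx_r. *)
Definition mulx r (f : {ffun I -> nat} -> k) u : k :=
  if admissible u && (0 < u r)%N then koszul r u * f (decr r u) else 0.

Definition derx r (f : {ffun I -> nat} -> k) u : k :=
  koszul r u * (u r).+1%:R * f (incr r u).

(* The Chevalley-Eilenberg differential is the odd derivation d for which
   X := sum_r x_r (x) e_r satisfies dX + [X, X] / 2 = 0, that is
     d x_t = - 1/2 sum_(r, s) (-1)^(|e_r| |x_s|) c r s t x_r x_s,
   whence d = sum_t (d x_t) d/dx_t. *)
Definition ce_diff (f : {ffun I -> nat} -> k) u : k :=
  \sum_t \sum_r \sum_s
    - 2^-1 * (-1) ^+ (par r && ~~ par s) * c r s t *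
    mulx r (mulx s (derx t f)) u.

(* [monomial p eps lam] indexes the x^u of degree [p], internal parity [eps] and
   weight [lam].  The bound on the exponents is implied by the degree, and makes
   the type finite. *)

Definition expo p (m : {ffun I -> 'I_p.+1}) : {ffun I -> nat} :=
  [ffun r => m r : nat].

Definition is_monomial p (eps : bool) lam (m : {ffun I -> 'I_p.+1}) : bool :=
  let u := expo m in
  [&& admissible u, degree u == p, parity u == eps & weight u == lam].

Definition monomial p eps lam : finType :=
  {m : {ffun I -> 'I_p.+1} | is_monomial eps lam m}.

Definition cochain p eps lam : vectType k := {ffun monomial p eps lam -> k^o}.

Definition formal p eps lam (f : cochain p eps lam) u : k :=
  \sum_(m : monomial p eps lam | u == expo (val m)) f m.

(* [ce_diff] raises the degree by 1 and preserves parity and weight. *)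
Definition diff_fun p eps lam (f : cochain p eps lam) : cochain p.+1 eps lam :=
  [ffun m => ce_diff (formal f) (expo (val m))].

Definition diff p eps lam : 'Hom(cochain p eps lam, cochain p.+1 eps lam) :=
  linfun (@diff_fun p eps lam).

Definition cocycles p eps lam : {vspace cochain p eps lam} :=
  lker (diff p eps lam).

Definition coboundaries p eps lam : {vspace cochain p eps lam} :=
  match p with
  | 0 => 0%VS
  | q.+1 => limg (diff q eps lam)
  end.

(* The quotient of the cocycles by the coboundaries is represented by a
   complement of the latter in the former. *)
Definition cohomology p eps lam : {vspace cochain p eps lam} :=
  (cocycles p eps lam :\: coboundaries p eps lam)%VS.

(* Euler characteristic, for the total parity, of the weight [lam] part of the
   cohomology in degrees at most [P]. *)
Definition euler_char_upto (P : nat) lam : int :=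
  \sum_(p < P.+1) \sum_(eps : bool)
    (-1) ^+ (p + eps) * (\dim (cohomology p eps lam))%:Z.

Lemma mulx_linear r a f g u :
  mulx r (fun v => a * f v + g v) u = a * mulx r f u + mulx r g u.
Proof.
by rewrite /mulx; case: ifP => _; rewrite ?mulr0 ?addr0 // mulrDr mulrCA.
Qed.

Lemma derx_linear r a f g u :
  derx r (fun v => a * f v + g v) u = a * derx r f u + derx r g u.
Proof. by rewrite /derx mulrDr mulrCA. Qed.

Lemma ce_diff_linear a f g u :
  ce_diff (fun v => a * f v + g v) u = a * ce_diff f u + ce_diff g u.
Proof.
rewrite /ce_diff mulr_sumr -big_split; apply: eq_bigr => t _ /=.
rewrite mulr_sumr -big_split; apply: eq_bigr => r _ /=.
rewrite mulr_sumr -big_split; apply: eq_bigr => s _ /=.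
have -> : derx t (fun v => a * f v + g v) =
          (fun v => a * derx t f v + derx t g v).
  by apply/funext => v; rewrite derx_linear.
have -> : mulx s (fun v => a * derx t f v + derx t g v) =
          (fun v => a * mulx s (derx t f) v + mulx s (derx t g) v).
  by apply/funext => v; rewrite mulx_linear.
by rewrite mulx_linear mulrDr mulrCA.
Qed.

Lemma diff_fun_linear p eps lam : linear (@diff_fun p eps lam).
Proof.
move=> a f g; apply/ffunP => m; rewrite !ffunE.
have -> : formal (a *: f + g) = (fun v => a * formal f v + formal g v).
  apply/funext => v; rewrite /formal mulr_sumr -big_split /=.
  by apply: eq_bigr => q _; rewrite !ffunE.
exact: ce_diff_linear.
Qed.

HB.instance Definition _ p eps lam :=
  GRing.isLinear.Build k (cochain p eps lam) (cochain p.+1 eps lam) _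
    (@diff_fun p eps lam) (@diff_fun_linear p eps lam).

Lemma diffE p eps lam (f : cochain p eps lam) : diff p eps lam f = diff_fun f.
Proof. by rewrite /diff (lfunE (@diff_fun p eps lam)). Qed.

End Cochains.

(* Indices are shifted to start from 0: the even (resp. odd) coordinate lines
  are the images of [lshift N] (resp. [rshift N]) in ['I_(N + N)]. *)

Section NilpotentRadical.

Variable N : nat.

Definition is_shuffle (pi : 'S_(N + N)) : Prop :=
  (forall i j : 'I_N, (i < j)%N -> (pi (lshift N i) < pi (lshift N j))%N) /\
  (forall i j : 'I_N, (i < j)%N -> (pi (rshift N i) < pi (rshift N j))%N).

Definition odd_line (i : 'I_(N + N)) : bool := (N <= i)%N.

(* [(i, j)] indexes the line Hom(k_i, k_j) of n_pi *)
Definition root (pi : 'S_(N + N)) : finType :=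
  {r : 'I_(N + N) * 'I_(N + N) | (pi r.1 < pi r.2)%N}.

Definition root_par pi (r : root pi) : bool :=
  odd_line (val r).1 (+) odd_line (val r).2.

(* Matrices act on column vectors, so that Hom(k_i, k_j) is spanned by the
   matrix unit at row j and column i. *)
Definition root_mx (k : fieldType) pi (r : root pi) : 'M[k]_(N + N) :=
  delta_mx (val r).2 (val r).1.

(* for A, B homogeneous of parities a, b *)
Definition supercomm (k : fieldType) (a b : bool) (A B : 'M[k]_(N + N)) :
    'M[k]_(N + N) :=
  A *m B - (-1) ^+ (a && b) *: (B *m A).

Definition root_bracket (k : fieldType) pi (r s : root pi) : 'M[k]_(N + N) :=
  supercomm (root_par r) (root_par s) (root_mx k r) (root_mx k s).

Definition struct_const (k : fieldType) pi (r s t : root pi) : k :=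
  root_bracket k r s (val t).2 (val t).1.

Lemma root_bracketE (k : fieldType) pi (r s : root pi) :
  root_bracket k r s = \sum_t struct_const k r s t *: root_mx k t.
Proof.
have [A hA] : exists A : 'M[k]_(N + N), A = root_bracket k r s by eexists.
rewrite /struct_const -hA.
have A0 i j : ~~ (pi j < pi i)%N -> A i j = 0.
  rewrite hA /root_bracket /supercomm /root_mx !mul_delta_mx_cond.
  case: r s {hA} => [[i1 j1] /= h1] [[i2 j2] /= h2] ji.
  rewrite !mxE !mulrb; apply/eqP; rewrite subr_eq0; apply/eqP.
  have aux i3 j3 i4 j4 : (pi i3 < pi j3)%N -> (pi i4 < pi j4)%N ->
     (if i3 == j4 then delta_mx j3 i4 else 0 : 'M[k]_(N + N)) i j = 0.
    move=> h3 h4; case: eqP => [e|_]; rewrite !mxE //.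
    case: eqP => [ei|//] /=; case: eqP => [ej|//].
    by case/negP: ji; rewrite ei ej (ltn_trans h4) // -e.
  by rewrite !aux // mulr0.
rewrite [LHS]matrix_sum_delta; apply/matrixP => i j.
rewrite -matrix_sum_delta summxE.
have [ji|ji] := boolP (pi j < pi i)%N.
  rewrite (bigD1 (exist _ (j, i) ji : root pi)) //= big1 ?addr0 => [|t].
    by rewrite !mxE !eqxx mulr1.
  rewrite -val_eqE /= !mxE; case: t => [[j' i'] /= _] ne.
  case: eqP => [ei|_] /=; last by rewrite mulr0.
  case: eqP => [ej|_] /=; last by rewrite mulr0.
  by rewrite ei ej eqxx in ne.
rewrite A0 // big1 // => t _; rewrite !mxE; case: t => [[j' i'] /= h].
case: eqP => [ei|_] /=; last by rewrite mulr0.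
case: eqP => [ej|_] /=; last by rewrite mulr0.
by rewrite ei ej h in ji.
Qed.

(* e_i - e_j, the exponent of s_i / s_j *)
Definition alpha (i j : 'I_(N + N)) : 'rV[int]_(N + N) :=
  delta_mx 0 i - delta_mx 0 j.

(* the weight of the generator dual to Hom(k_i, k_j) *)
Definition root_wt pi (r : root pi) : 'rV[int]_(N + N) :=
  alpha (val r).1 (val r).2.

(* Each generator contributes at least 1 to |sum_i pi(i) lam_i|, which thus
   bounds the degrees of the cochains of weight [lam]: see
   [cochain_deg_bound]. *)
Definition deg_bound (pi : 'S_(N + N)) (lam : 'rV[int]_(N + N)) : nat :=
  absz (\sum_i (pi i)%:Z * lam 0 i).

Lemma cochain_deg_bound pi p eps lam :
  (deg_bound pi lam < p)%N ->
  #|monomial (@root_par pi) (@root_wt pi) p eps lam| = 0%N.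
Proof.
move=> lt_p; apply/eqP/negPn/negP; rewrite -lt0n => /card_gt0P[[m hm] _].
case/and4P: hm; set u := expo m => _ /eqP dp _ /eqP wl.
move: lt_p; rewrite ltnNge /deg_bound => /negP; apply.
have -> : \sum_i (pi i)%:Z * lam 0 i =
          - (\sum_(r : root pi) (pi (val r).2 - pi (val r).1)%N * u r)%N%:Z
          :> int.
  have lamE i : lam 0 i = \sum_r (root_wt r *+ u r) 0 i.
    by rewrite -wl /weight summxE.
  transitivity (\sum_i \sum_r (pi i)%:Z * (root_wt r *+ u r) 0 i : int).
    by apply: eq_bigr => i _; rewrite lamE mulr_sumr.
  rewrite exchange_big /= (big_morph Posz PoszD (erefl _)) -sumrN.
  apply: eq_bigr => r _.
  have termE i : (pi i)%:Z * (root_wt r *+ u r) 0 i =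
      ((pi i)%:Z * (i == (val r).1)%:R - (pi i)%:Z * (i == (val r).2)%:R) *
      (u r)%:Z.
    rewrite mulmxnE /root_wt /alpha !mxE eqxx /=.
    by rewrite -[_ *+ u r]mulr_natr natz mulrA mulrBr.
  have pick l : \sum_i (pi i)%:Z * (i == l)%:R = (pi l)%:Z.
    rewrite (bigD1 l) //= eqxx mulr1 big1 ?addr0 // => i /negPf ->.
    exact: mulr0.
  under [LHS]eq_bigr do rewrite termE.
  rewrite -mulr_suml sumrB !pick PoszM -mulNr -subzn ?opprB //.
  by rewrite ltnW //; case: (r).
rewrite abszN absz_nat -[X in (X <= _)%N]dp /degree.
apply: leq_sum => -[[i j] /= h] _.
by rewrite leq_pmull // subn_gt0.
Qed.

Definition euler_char (k : fieldType) (pi : 'S_(N + N))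
    (lam : 'rV[int]_(N + N)) : int :=
  euler_char_upto (@root_par pi) (@struct_const k pi) (@root_wt pi)
    (deg_bound pi lam) lam.

(* 1, N+1, 2, N+2, ..., N, 2N is the order of the indices; from 0, the shuffle is
   i |-> 2i, N + i |-> 2i + 1. *)
Definition pi1_fun (i : 'I_(N + N)) : 'I_(N + N) :=
  match fintype.split i with
  | inl j => insubd i j.*2
  | inr j => insubd i j.*2.+1
  end.

Lemma pi1_fun_lshift (i : 'I_N) : pi1_fun (lshift N i) = i.*2 :> nat.
Proof.
rewrite /pi1_fun (unsplitK (inl i)) val_insubd.
by rewrite ifT // addnn ltn_double ltn_ord.
Qed.

Lemma pi1_fun_rshift (i : 'I_N) : pi1_fun (rshift N i) = i.*2.+1 :> nat.
Proof.
rewrite /pi1_fun (unsplitK (inr i)) val_insubd.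
by rewrite ifT // addnn ltn_Sdouble ltn_ord.
Qed.

Lemma pi1_inj : injective pi1_fun.
Proof.
move=> i j /(congr1 val) /=.
case: (split_ordP i) => i' ->; case: (split_ordP j) => j' ->;
  rewrite ?pi1_fun_lshift ?pi1_fun_rshift.
- by move/double_inj/val_inj ->.
- by move/(congr1 odd); rewrite /= !odd_double.
- by move/(congr1 odd); rewrite /= !odd_double.
- by case=> /double_inj/val_inj ->.
Qed.

Definition pi1 : 'S_(N + N) := perm pi1_inj.

Definition delta (pi : 'S_(N + N)) : 'rV[int]_(N + N) :=
  \sum_(i < N) \sum_(j < N | (pi (rshift N j) < pi (lshift N i))%N)
    alpha (rshift N j) (lshift N i).

(* A bijection from the even to the odd indices is represented by
  [phi : 'S_N]. *)

Definition match_idx (phi : 'S_N) (i : 'I_N) : 'I_(N + N) := rshift N (phi i).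

Definition sector (phi : 'S_N) (pi : 'S_(N + N)) (lam : 'rV[int]_(N + N)) :
    Prop :=
  exists a : 'I_N -> int,
    [/\ forall i, (pi (lshift N i) < pi (match_idx phi i))%N -> 0 <= a i,
        forall i, (pi (match_idx phi i) < pi (lshift N i))%N -> a i < 0 &
        lam = \sum_i alpha (lshift N i) (match_idx phi i) *~ a i].

Variable R : realType.

Definition segment (A B : R * R) : set (R * R) :=
  [set P | exists2 t : R, 0 <= t <= 1 &
     P = ((1 - t) * A.1 + t * B.1, (1 - t) * A.2 + t * B.2)].

(* going around the unit circle at most once, the angle decreasing *)
Definition clockwise (a : 'I_(N + N) -> R * R) : Prop :=
  exists theta : 'I_(N + N) -> R,
    [/\ forall i j : 'I_(N + N), (i < j)%N -> theta j < theta i,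
        forall i j, theta i - theta j < trigo.pi *+ 2 &
        forall i, a i = (cos (theta i), sin (theta i))].

(* no three chords with distinct endpoints are concurrent *)
Definition general_position (a : 'I_(N + N) -> R * R) : Prop :=
  forall i1 j1 i2 j2 i3 j3, uniq [:: i1; j1; i2; j2; i3; j3] ->
  forall P, ~ [/\ segment (a i1) (a j1) P, segment (a i2) (a j2) P &
                  segment (a i3) (a j3) P].

Definition chord (a : 'I_(N + N) -> R * R) (phi : 'S_N) (pi : 'S_(N + N))
    (i : 'I_N) : set (R * R) :=
  segment (a (pi (lshift N i))) (a (pi (match_idx phi i))).

Definition crossings (a : 'I_(N + N) -> R * R) (phi : 'S_N)
    (pi : 'S_(N + N)) : set (R * R) :=
  [set P | exists i j : 'I_N,
     [/\ i != j, chord a phi pi i P & chord a phi pi j P]].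

(* [fset_set] is the finite set underlying a finite classical set *)
Definition crossing_number a phi pi : nat := #|` fset_set (crossings a phi pi)|.

Definition I_ind (a : 'I_(N + N) -> R * R) (pi : 'S_(N + N)) (phi : 'S_N)
    (lam : 'rV[int]_(N + N)) : int :=
  if `[< sector phi pi lam >] then (-1) ^+ crossing_number a phi pi else 0.

End NilpotentRadical.

(* Main.v *)
From HB Require Import structures.
Require Import Defs.
From mathcomp Require Import finmap boolp classical_sets functions cardinality.
From mathcomp Require Import all_boot all_order all_algebra all_fingroup.
From mathcomp Require Import reals trigo ring lra zify.

Set Implicit Arguments.
Unset Strict Implicit.
Unset Printing Implicit Defensive.

Import Order.TTheory GRing.Theory Num.Theory.

Local Open Scope ring_scope.

(** The Euler characteristic of a finite complex can be read off its terms, so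
[c_lam] is a signed count of the monomials of weight [lam] in the cochain
algebra, and its generating series is a product over the roots (p, q) of
n_pi: a factor 1 - s_p / s_q when p and q have the same parity, and
1 / (1 - s_p / s_q) otherwise, expanded in the region where all the s_p / s_q
with pi p < pi q are small. Write x_i and y_j for the even and odd variables.
Up to a sign and a monomial, the product is
V(x) V(y) / prod_(i, j) (y_j - x_i), V being the Vandermonde product, and
Cauchy's determinant expands this as
sum_phi sgn(phi) prod_i 1 / (1 - x_i / y_(phi i)). In the region of pi, each
summand is, up to a sign, the sum of the s^mu over mu in the sector of phi.
This is (a), once the signs are compared.

Reading the characteristic off the terms needs the coboundaries to be cocycles,
that is d^2 = 0 for the Chevalley-Eilenberg differential in its explicit
coordinates ([gl_ce_diff_sq]). The operator d^2 commutes with multiplication by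
each generator as soon as it kills the generators ([ce_diff_sq_mulx]), and for
matrix units d x_(p,q) = sum_m +- x_(p,m) x_(m,q), so that d^2 x_(p,q) = 0 by
associativity of the composition of arrows ([gl_jacobi]). Then [euler_charE]
expresses the Euler characteristic as a count of monomials.

No infinite series is multiplied. Laurent polynomials are realised as shift
operators acting on all functions on the weight lattice, and a series is such
a function. The product formula becomes an equation between operators applied
to the series and to the Dirac function ([generating_function]); on functions
supported in a half-space, T_v - T_w is injective when v and w have different
levels ([regular_mono_sub]), which replaces the uniqueness of expansions.
The comparison of both sides is [euler_char_sector_sum].

For the sign, two chords cross exactly when their ends interleave: the
orientation of a triangle inscribed in the circle is a product of three sines of
half differences of angles. General position makes the crossing points of
distinct pairs of chords distinct, and counting the interleaved pairs
modulo 2 gives [crossing_sign].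

For (b), the sum over phi is, up to sign, the determinant of the matrix whose
entry (i, j) is 0 or +-1 according to whether the weight lies in the sector
condition of the pair (i, j). Since pi is a total order, the supports of any
two rows are nested or disjoint, the sign is constant along each row, and such a
determinant is 0 or +-1 ([det_signed_laminar]). *)

(** * Super Weyl algebra relations *)

Section Oscillators.

Variables (k : fieldType) (I : finType) (par : I -> bool).

Implicit Types (r s t : I) (u v : {ffun I -> nat}) (f g : {ffun I -> nat} -> k^o).

Local Notation F := ({ffun I -> nat} -> k^o).
Local Notation X := (@mulx k I par).
Local Notation D := (@derx k I par).
Local Notation K := (@koszul k I par).

(** The Koszul sign of the exchange of x_r and x_s. *)
Definition swap_sign r s : k := (-1) ^+ (~~ par r && ~~ par s).

(** Formal cochains are defined on all exponents; the genuine ones vanish where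
an exterior generator is repeated. The commutation rule [derx_mulx] holds on
these only. *)
Definition adm_supported (f : F) := forall u, ~~ admissible par u -> f u = 0.

Lemma scalefE a f u : (a *: f) u = a * f u. Proof. by []. Qed.
Lemma addfE f g u : (f + g) u = f u + g u. Proof. by []. Qed.

Lemma incrE r u s : incr r u s = (u s + (s == r))%N.
Proof. by rewrite ffunE. Qed.

Lemma decr_incr r u : decr r (incr r u) = u.
Proof. by apply/ffunP => s; rewrite !ffunE addnK. Qed.

Lemma incr_decr r u : (0 < u r)%N -> incr r (decr r u) = u.
Proof.
move=> ur; apply/ffunP => s; rewrite !ffunE subnK //.
by case: eqP => [->|].
Qed.

Lemma incrC r s u : incr r (incr s u) = incr s (incr r u).
Proof. by apply/ffunP => t; rewrite !ffunE addnAC. Qed.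

Lemma incr_cases r u : u r = 0%N \/ exists v, u = incr r v.
Proof.
case: (posnP (u r)) => [->|ur]; first by left.
by right; exists (decr r u); rewrite incr_decr.
Qed.

Lemma admissible_incr r u : admissible par (incr r u) -> admissible par u.
Proof.
move=> /forallP h; apply/forallP => s; move: (h s); rewrite incrE.
by case: (par s) => //= /(leq_trans (leq_addr _ _)).
Qed.

Lemma admissible_incrE r u : admissible par u ->
  admissible par (incr r u) = par r || (u r == 0)%N.
Proof.
move=> /forallP h; apply/forallP/idP => [/(_ r)|hr s].
  by rewrite incrE eqxx addn1 ltnS leqn0.
rewrite incrE; case: eqP => [->|_]; last by rewrite addn0.
by case/orP: hr => [->//|/eqP ->]; rewrite orbT.
Qed.

(** Once exponents are written as successive increments, multiplications and
derivations only produce Koszul signs, and their commutation rules follow from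
this one. *)
Lemma koszul_incr r s u :
  K r (incr s u) =
  (-1) ^+ [&& ~~ par r, ~~ par s & (enum_rank s < enum_rank r)%N] * K r u.
Proof.
rewrite /koszul; case: (par r) => /=; first by rewrite mulr1.
set c := _ && _; rewrite -exprD; congr (_ ^+ _).
have [hc|hc] := boolP c.
  rewrite [in LHS](bigD1 s) //= [in RHS](bigD1 s) //= incrE eqxx.
  rewrite addn1 add1n addSn; congr (_ + _).+1.
  by apply: eq_bigr => t /andP[_ /negPf ts]; rewrite incrE ts addn0.
rewrite add0n; apply: eq_bigr => t ht; rewrite incrE.
by case: eqP ht => [->|_ _]; rewrite ?addn0 // -/c (negPf hc).
Qed.

Lemma koszul_incr_self r u : K r (incr r u) = K r u.
Proof. by rewrite koszul_incr ltnn !andbF mul1r. Qed.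

Lemma koszul_sqr r u : K r u * K r u = 1.
Proof.
rewrite /koszul; case: ifP => _; first by rewrite mul1r.
by rewrite -expr2 sqrr_sign.
Qed.

Lemma mulx0 r f u : u r = 0%N -> X r f u = 0.
Proof. by move=> ur; rewrite /mulx ur andbF. Qed.

Lemma mulx_incr r f u :
  X r f (incr r u) = if admissible par (incr r u) then K r u * f u else 0.
Proof.
by rewrite /mulx incrE eqxx addn1 andbT decr_incr koszul_incr_self.
Qed.

Lemma mulx_adm r f : adm_supported (X r f).
Proof. by move=> u /negPf nu; rewrite /mulx nu. Qed.

Lemma derx_adm r f : adm_supported f -> adm_supported (D r f).
Proof.
move=> hf u nu; rewrite /derx hf ?mulr0 //.
by apply: contra nu; apply: admissible_incr.
Qed.

Lemma mulx_is_linear r : linear (X r : F -> F).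
Proof. by move=> a f g; apply/funext => u; apply: mulx_linear. Qed.

Lemma derx_is_linear r : linear (D r : F -> F).
Proof. by move=> a f g; apply/funext => u; apply: derx_linear. Qed.

HB.instance Definition _ r := GRing.isLinear.Build k F F *:%R
  (X r : F -> F) (mulx_is_linear r).

HB.instance Definition _ r := GRing.isLinear.Build k F F *:%R
  (D r : F -> F) (derx_is_linear r).

Lemma mulx_self r f : ~~ par r -> X r (X r f) = 0 :> F.
Proof.
move=> pr; apply/funext => u.
have [u0|[v ->]] := incr_cases r u; first by rewrite mulx0.
rewrite mulx_incr; have [v0|[w ->]] := incr_cases r v.
  by rewrite mulx0 // mulr0; case: ifP.
case: ifP => // /forallP/(_ r); rewrite (negPf pr) !incrE eqxx.
by rewrite addn1 addn1.
Qed.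

Lemma mulxC r s f : X r (X s f) = swap_sign r s *: (X s (X r f) : F).
Proof.
have [<-{s}|rs] := eqVneq r s.
  rewrite /swap_sign andbb; have [pr|pr] := boolP (par r).
    by rewrite scale1r.
  by rewrite mulx_self // scaler0.
have sr : (s == r) = false by rewrite eq_sym (negPf rs).
apply/funext => u; rewrite scalefE.
have [u0|[v uE]] := incr_cases r u.
  rewrite mulx0 //; have [us|[v uE]] := incr_cases s u.
    by rewrite mulx0 // mulr0.
  rewrite uE mulx_incr [X r f v]mulx0; first by case: ifP; rewrite !mulr0.
  by move: u0; rewrite uE incrE (negPf rs) addn0.
have [v0|[w vE]] := incr_cases s v.
  have us : u s = 0%N by rewrite uE incrE sr v0.
  by rewrite [X s _ u]mulx0 // mulr0 uE mulx_incr mulx0 // mulr0 if_same.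
rewrite uE vE mulx_incr [in RHS]incrC !mulx_incr incrC.
case: ifP => [ha|_]; last by rewrite mulr0.
rewrite (admissible_incr ha); move: ha; rewrite incrC => /admissible_incr ->.
rewrite !koszul_incr /swap_sign !mulrA; congr (_ * f w).
rewrite [RHS]mulrAC; congr (_ * _ * _).
case: (par r); case: (par s) => //=; rewrite ?mul1r ?mulr1 //.
have : enum_rank s != enum_rank r by rewrite (inj_eq enum_rank_inj) sr.
rewrite -(inj_eq val_inj) neq_ltn => /orP[] h; rewrite h ltnNge ltnW //=.
  by rewrite mulr1.
by rewrite mulrNN mulr1.
Qed.

(** The canonical supercommutation relation. When [t = s] is exterior, exactly
one of the two products survives: [derx] after [mulx] if x_t is absent from the
monomial, [mulx] after [derx] if it is present. *)
Lemma derx_mulx t s f : adm_supported f ->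
  D t (X s f) = (t == s)%:R *: f + swap_sign t s *: (X s (D t f) : F).
Proof.
move=> hf; apply/funext => u.
rewrite addfE !scalefE.
have [au|nu] := boolP (admissible par u); last first.
  rewrite [in RHS](mulx_adm _ _ nu) hf // !mulr0 addr0.
  by rewrite derx_adm //; apply: mulx_adm.
rewrite {1}/derx.
have [<-{s}|ts] := eqVneq t s.
  rewrite mulx_incr admissible_incrE // mul1r /swap_sign andbb.
  have [u0|[v uE]] := incr_cases t u.
    by rewrite u0 orbT mulr1 mulrA koszul_sqr mul1r mulx0 // mulr0 addr0.
  subst u; rewrite mulx_incr au /derx incrE eqxx addn1 koszul_incr_self orbF.
  move: (koszul_sqr t v) => kk; case: ifP => pt /=.
    rewrite -[_.+2]addn1 natrD mul1r; move: kk; move: (K t v) => c kk.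
    move: (f _ : k) => z; 
    transitivity (z * (c * c) + (c * c) * (v t).+1%:R * z :> k).
      by ring.
    by rewrite !mulrA kk -mulrA kk mulr1.
  rewrite mulr0; move/forallP: au => /(_ t); rewrite pt incrE eqxx /=.
  rewrite addn1 ltnS leqn0 => /eqP ->; rewrite mulr1 mulrA kk.
  by rewrite mul1r mulN1r subrr.
rewrite mul0r add0r.
have [u0|[v uE]] := incr_cases s u.
  by rewrite [X s f _]mulx0 ?mulx0 ?mulr0 // incrE eq_sym (negPf ts) u0.
subst u; rewrite incrC !mulx_incr au incrE (negPf ts) addn0 /derx.
case: ifP => [ha|nha]; last first.
  rewrite hf; first by rewrite !mulr0.
  apply: contraFN nha => ha.
  have st : (s == t) = false by rewrite eq_sym (negPf ts).
  rewrite (admissible_incrE s ha) incrE st addn0.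
  by rewrite -(admissible_incrE s (admissible_incr au)).
rewrite !koszul_incr /swap_sign !mulrA; congr (_ * f _).
rewrite ![_ * (v t).+1%:R]mulrC -!mulrA; congr (_ * _).
rewrite [RHS]mulrCA [in RHS]mulrCA; rewrite !mulrA.
have : enum_rank s != enum_rank t.
  by rewrite (inj_eq enum_rank_inj) eq_sym.
rewrite -(inj_eq val_inj) neq_ltn.
case: (par t); case: (par s); rewrite /= ?mul1r ?mulr1; try by rewrite mulrC.
by case/orP=> h; rewrite h ltnNge ltnW //= ?mulr1 ?mul1r; ring.
Qed.

End Oscillators.

(** * The square of the Chevalley-Eilenberg differential *)

Section DifferentialSquare.

Variables (k : fieldType) (I : finType) (par : I -> bool).
Variable (c : I -> I -> I -> k).

Hypothesis c_par : forall r s t, c r s t != 0 -> par r (+) par s = par t.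

Local Notation F := ({ffun I -> nat} -> k^o).
Local Notation X := (@mulx k I par).
Local Notation D := (@derx k I par).
Local Notation d := (ce_diff par c).
Local Notation e := (swap_sign k par).

Implicit Types (r s t w : I) (u v : {ffun I -> nat}) (f g : F).

Definition ce_coef r s t : k := - 2^-1 * (-1) ^+ (par r && ~~ par s) * c r s t.

(** Multiplication by d x_t. *)
Definition muldx t f : F :=
  \sum_r \sum_s ce_coef r s t *: (X r (X s f) : F).

(** The sign (-1)^|x_r|, generators having total parity opposite to [par]. *)
Definition par_sign r : k := (-1) ^+ (~~ par r).

Lemma ce_coef_par r s t : ce_coef r s t != 0 -> par r (+) par s = par t.
Proof. by rewrite mulf_eq0 => /norP[_]; apply: c_par. Qed.

Lemma muldx_is_linear t : linear (muldx t).
Proof.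
move=> a f g; rewrite /muldx scaler_sumr -big_split; apply: eq_bigr => r _ /=.
rewrite scaler_sumr -big_split; apply: eq_bigr => s _ /=.
by rewrite !linearP.
Qed.

HB.instance Definition _ t := GRing.isLinear.Build k F F *:%R (muldx t)
  (muldx_is_linear t).

Lemma ce_diffE f : d f = \sum_t muldx t (D t f).
Proof.
apply/funext => u; rewrite /ce_diff fct_sumE; apply: eq_bigr => t _.
rewrite /muldx fct_sumE; apply: eq_bigr => r _.
by rewrite fct_sumE; apply: eq_bigr => s _.
Qed.

Lemma ce_diff_is_linear : linear (d : F -> F).
Proof. by move=> a f g; apply/funext => u; apply: ce_diff_linear. Qed.

HB.instance Definition _ := GRing.isLinear.Build k F F *:%R (d : F -> F)
  ce_diff_is_linear.

Lemma muldx_adm t f : adm_supported par (muldx t f).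
Proof.
move=> u nu; rewrite /muldx fct_sumE big1 // => r _; rewrite fct_sumE big1 //.
by move=> s _; rewrite scalefE mulx_adm ?mulr0.
Qed.

Lemma ce_diff_adm f : adm_supported par (d f).
Proof.
move=> u nu; rewrite ce_diffE fct_sumE big1 // => t _.
exact: muldx_adm.
Qed.

(** d x_t has parity opposite to x_t, hence the extra [par_sign w]. *)
Lemma muldx_mulx t w f :
  muldx t (X w f) = (e t w * par_sign w) *: (X w (muldx t f) : F).
Proof.
rewrite /muldx linear_sum scaler_sumr; apply: eq_bigr => r _ /=.
rewrite linear_sum scaler_sumr; apply: eq_bigr => s _ /=.
have [->|/ce_coef_par h] := eqVneq (ce_coef r s t) 0.
  by rewrite !scale0r linear0 scaler0.
have sgn : e s w * e r w = e t w * par_sign w.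
  rewrite /swap_sign /par_sign -h.
  by case: (par r); case: (par s); case: (par w) => //=;
    rewrite ?expr0 ?expr1 ?mulrNN ?mulr1 ?mul1r.
rewrite (mulxC par s w) linearZ /= (mulxC par r w) [in RHS]linearZ /=.
rewrite !scalerA; congr (_ *: _); rewrite -sgn.
by rewrite -mulrA mulrC.
Qed.

(** The Leibniz rule for left multiplication by a generator: the contraction
terms of [derx_mulx] assemble into [muldx w f]. *)
Lemma ce_diff_mulx w f : adm_supported par f ->
  d (X w f) = muldx w f + par_sign w *: (X w (d f) : F).
Proof.
move=> hf; rewrite !ce_diffE linear_sum scaler_sumr.
transitivity (\sum_t ((t == w)%:R *: muldx t f +
    par_sign w *: (X w (muldx t (D t f)) : F))).
  apply: eq_bigr => t _; rewrite derx_mulx // linearD !linearZ /=.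
  rewrite muldx_mulx; congr (_ + _).
  by rewrite scalerA mulrA -expr2 sqrr_sign mul1r.
rewrite big_split /=; congr (_ + _).
rewrite (bigD1 w) //= eqxx scale1r big1 ?addr0 // => t /negPf ->.
by rewrite scale0r.
Qed.

(** Multiplication by d (d x_t). *)
Definition mulddx t f : F :=
  \sum_r \sum_s ce_coef r s t *:
    (muldx r (X s f) + par_sign r *: (X r (muldx s f) : F)).

Lemma ce_diff_muldx t f : adm_supported par f ->
  d (muldx t f) = mulddx t f - par_sign t *: muldx t (d f).
Proof.
move=> hf; rewrite /mulddx [muldx t f]/muldx [muldx t (d f)]/muldx linear_sum
  scaler_sumr -sumrB.
apply: eq_bigr => r _; rewrite linear_sum scaler_sumr -sumrB.
apply: eq_bigr => s _; rewrite linearZ /=.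
have [->|/ce_coef_par h] := eqVneq (ce_coef r s t) 0.
  by rewrite !scale0r scaler0 subr0.
rewrite ce_diff_mulx; last exact: mulx_adm.
rewrite ce_diff_mulx // (linearD (X r : F -> F)) (linearZ_LR (X r : F -> F)) /=.
rewrite (scalerDr (par_sign r)) addrA scalerDr; congr (_ + _).
have sgn : par_sign r * par_sign s = - par_sign t.
  rewrite /par_sign -h; case: (par r); case: (par s) => //=;
    by rewrite ?expr0 ?expr1 ?mulrNN ?mulr1 ?mul1r ?opprK.
by rewrite !scalerA -scaleNr -mulrA sgn mulrN mulrC.
Qed.

Hypothesis dd_generators : forall t f, adm_supported par f -> mulddx t f = 0.

(** An odd derivation has a square that is an even derivation; as this one
kills the generators, it commutes with multiplication by them. *)
Lemma ce_diff_sq_mulx w f : adm_supported par f ->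
  d (d (X w f)) = X w (d (d f)).
Proof.
move=> hf; rewrite ce_diff_mulx // linearD linearZ /= ce_diff_muldx // dd_generators //.
rewrite ce_diff_mulx; last exact: ce_diff_adm.
rewrite scalerDr scalerA -expr2 sqrr_sign scale1r.
by rewrite sub0r addKr.
Qed.

Definition basis_cochain u : F := fun v => (u == v)%:R.

Lemma basis_cochain_adm u : admissible par u -> adm_supported par (basis_cochain u).
Proof.
by move=> au v; rewrite /basis_cochain; case: eqP => // <-; rewrite au.
Qed.

(** Each monomial is obtained from 1, which d kills, by multiplications by
generators. *)
Lemma ce_diff_sq_basis u : admissible par u -> d (d (basis_cochain u)) = 0.
Proof.
have [n] := ubnP (degree u); elim: n u => // n IHn u le_n au.
have [u0|/existsP[r]] := boolP [forall r, u r == 0%N].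
  suff -> : d (basis_cochain u) = 0 by rewrite linear0.
  rewrite ce_diffE big1 // => t _; suff -> : D t (basis_cochain u) = 0.
    by rewrite linear0.
  apply/funext => v; rewrite /derx /basis_cochain; case: eqP => [uE|].
    by move/forallP: u0 => /(_ t); rewrite uE incrE eqxx addn1.
  by rewrite mulr0.
rewrite -lt0n => ur.
have [v uE] : exists v, u = incr r v by exists (decr r u); rewrite incr_decr.
have av : admissible par v by apply: (@admissible_incr _ par r); rewrite -uE.
have XE : X r (basis_cochain v) = koszul k par r v *: basis_cochain u.
  apply/funext => v1; rewrite scalefE; have [w0|[w' ->]] := incr_cases r v1.
    rewrite mulx0 // /basis_cochain; case: eqP => [uw|]; last by rewrite mulr0.
    by rewrite uw w0 in ur.
  rewrite mulx_incr /basis_cochain uE.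
  have -> : (incr r v == incr r w') = (v == w').
    by apply/eqP/eqP => [/(congr1 (decr r))|->//]; rewrite !decr_incr.
  by case: eqP => [<-|_]; rewrite -?uE ?au // !mulr0 if_same.
have : d (d (X r (basis_cochain v))) = 0.
  rewrite ce_diff_sq_mulx; last exact: basis_cochain_adm.
  rewrite IHn ?linear0 //; move: le_n; rewrite ltnS; apply: leq_trans.
  rewrite uE /degree (bigD1 r) //= [X in (_ < X)%N](bigD1 r) //= incrE eqxx.
  rewrite addn1 addSn ltnS leq_add2l; apply: leq_sum => s _.
  by rewrite incrE leq_addr.
rewrite XE !linearZ /= => /(congr1 (fun f => koszul k par r v *: f)).
by rewrite scalerA koszul_sqr scale1r scaler0.
Qed.

End DifferentialSquare.

(** * Vanishing of d^2 for upper triangular matrices *)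

Section GlJacobi.

Variables (k : fieldType) (N : nat) (pi : 'S_(N + N)).
Hypothesis two_neq0 : 2 != 0 :> k.

Local Notation I := (Defs.root pi).
Local Notation par := (@root_par N pi).
Local Notation sc := (@struct_const N k pi).
Local Notation F := ({ffun I -> nat} -> k^o).
Local Notation X := (@mulx k I par).

Implicit Types (r s t w q : I) (f g : F).

(** A root (p, q) is seen as an arrow from p to q; [chain r s t] says that [t]
is [r] followed by [s]. *)
Definition chain r s t :=
  [&& (val r).1 == (val t).1, (val r).2 == (val s).1 & (val s).2 == (val t).2].

(** The two products in the supercommutator of matrix units. *)
Lemma struct_constE r s t :
  sc r s t = (chain s r t)%:R - (-1) ^+ (par r && par s) * (chain r s t)%:R.
Proof.
rewrite /struct_const /root_bracket /supercomm /root_mx !mul_delta_mx_cond.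
rewrite !mxE !mulmxnE !mxE /chain.
rewrite -![_%:R *+ _]mulrnA !mulnb.
rewrite ![(val t).2 == _]eq_sym ![(val t).1 == _]eq_sym.
rewrite ![(val r).1 == (val s).2]eq_sym.
rewrite [(val s).1 == (val r).2]eq_sym.
by congr ((nat_of_bool _)%:R - _ * (nat_of_bool _)%:R); do !case: eqP.
Qed.

Lemma chain_par r s t : chain r s t -> par r (+) par s = par t.
Proof.
case/and3P=> /eqP h1 /eqP h2 /eqP h3; rewrite /root_par h1 h2 h3.
by case: (odd_line _); case: (odd_line _); case: (odd_line _).
Qed.

Lemma struct_const_par r s t : sc r s t != 0 -> par r (+) par s = par t.
Proof.
rewrite struct_constE; have [h|_] := boolP (chain s r t).
  by rewrite addbC (chain_par h).
have [h|_] := boolP (chain r s t); first by rewrite (chain_par h).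
by rewrite mulr0 subr0 eqxx.
Qed.

Definition gl_coef r s t : k := (chain r s t)%:R * (-1) ^+ par r.

(** The two products in the supercommutator contribute equally to d x_t, up to
the exchange of two generators, which cancels the factor 1/2. *)
Lemma sum_ce_coef t (B : I -> I -> F) :
  (forall r s, B s r = swap_sign k par r s *: B r s) ->
  \sum_r \sum_s ce_coef par sc r s t *: B r s =
  \sum_r \sum_s gl_coef r s t *: B r s.
Proof.
move=> Bsym.
pose h r s := - 2^-1 * (-1) ^+ (par r && ~~ par s) : k.
transitivity (\sum_r \sum_s (h r s * (chain s r t)%:R) *: B r s -
  \sum_r \sum_s (h r s * (-1) ^+ (par r && par s) * (chain r s t)%:R) *: B r s).
  rewrite -sumrB; apply: eq_bigr => r _; rewrite -sumrB; apply: eq_bigr => s _.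
  by rewrite /ce_coef struct_constE -scalerBl mulrBr -/(h r s) mulrA.
rewrite [X in X - _]exchange_big /= -sumrB; apply: eq_bigr => r _.
rewrite -sumrB; apply: eq_bigr => s _.
rewrite Bsym scalerA -scalerBl /h /gl_coef /swap_sign.
case: (chain r s t); last by rewrite !mulr0 !mul0r subr0.
congr (_ *: _); rewrite !mulr1 mul1r.
by case: (par r); case: (par s); rewrite /= ?expr0 ?expr1; field.
Qed.

Lemma muldx_gl t f :
  muldx par sc t f = \sum_r \sum_s gl_coef r s t *: (X r (X s f) : F).
Proof. by rewrite /muldx sum_ce_coef // => r s; rewrite mulxC /swap_sign andbC. Qed.

Definition chain3 r s w t := [&& (val r).1 == (val t).1,
  (val r).2 == (val s).1, (val s).2 == (val w).1 & (val w).2 == (val t).2].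

(** The total order on the lines ensures that composites of roots are
roots. *)
Lemma chain3P r s w t : chain3 r s w t ->
  (exists q, chain r s q) /\ (exists q, chain s w q).
Proof.
case/and4P=> /eqP h1 /eqP h2 /eqP h3 /eqP h4; split.
  have h : (pi (val r).1 < pi (val s).2)%N.
    by apply: ltn_trans (valP s); rewrite -h2 (valP r).
  by exists (exist _ ((val r).1, (val s).2) h); rewrite /chain /= !eqxx h2 eqxx.
have h : (pi (val s).1 < pi (val w).2)%N.
  by apply: ltn_trans (valP w); rewrite -h3 (valP s).
by exists (exist _ ((val s).1, (val w).2) h); rewrite /chain /= !eqxx h3 eqxx.
Qed.

Lemma chain_inj r s t t' : chain r s t -> chain r s t' -> t = t'.
Proof.
case/and3P=> /eqP h1 _ /eqP h3 /and3P[/eqP h1' _ /eqP h3'].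
apply/val_inj; move: h1 h3 h1' h3'.
by case: (val t) => ? ? /=; case: (val t') => ? ? /= -> -> -> ->.
Qed.

(** The next two lemmas evaluate both bracketings of a threefold composite:
the coefficients agree, since a composite arrow is determined by its ends. *)
Lemma gl_coef_assocl r s w t :
  \sum_q gl_coef q w t * gl_coef r s q =
  (chain3 r s w t)%:R * (-1) ^+ par s :> k.
Proof.
have [h|nh] := boolP (chain3 r s w t).
  have [[q hq] _] := chain3P h; rewrite (bigD1 q) //= big1 ?addr0; last first.
    move=> q' nq; rewrite /gl_coef; case hq': (chain r s q').
      by rewrite (chain_inj hq hq') eqxx in nq.
    by rewrite mul0r mulr0.
  rewrite /gl_coef hq -(chain_par hq); have -> : chain q w t.
    case/and3P: hq => /eqP h1 /eqP h2 /eqP h3.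
    by case/and4P: h => g1 g2 g3 g4; apply/and3P; rewrite -h1 -h3.
  by rewrite !mul1r -signr_addb addbAC addbb.
rewrite mul0r big1 // => q _; rewrite /gl_coef.
case h1: (chain q w t); last by rewrite !mul0r.
case h2: (chain r s q); last by rewrite mul0r mulr0.
case/negP: nh; case/and3P: h1 => /eqP a1 /eqP a2 /eqP a3.
case/and3P: h2 => /eqP b1 /eqP b2 /eqP b3.
by rewrite /chain3 b1 a1 b2 b3 a2 a3 !eqxx.
Qed.

Lemma gl_coef_assocr r s w t :
  \sum_q gl_coef r q t * (-1) ^+ par r * gl_coef s w q =
  (chain3 r s w t)%:R * (-1) ^+ par s :> k.
Proof.
have [h|nh] := boolP (chain3 r s w t).
  have [_ [q hq]] := chain3P h; rewrite (bigD1 q) //= big1 ?addr0; last first.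
    move=> q' nq; rewrite /gl_coef; case hq': (chain s w q').
      by rewrite (chain_inj hq hq') eqxx in nq.
    by rewrite mul0r mulr0.
  rewrite /gl_coef hq; have -> : chain r q t.
    case/and3P: hq => /eqP h1 /eqP h2 /eqP h3.
    by case/and4P: h => g1 g2 g3 g4; apply/and3P; rewrite -h1 -h3.
  by rewrite !mul1r -signr_addb addbb mul1r.
rewrite mul0r big1 // => q _; rewrite /gl_coef.
case h1: (chain r q t); last by rewrite !mul0r.
case h2: (chain s w q); last by rewrite mul0r mulr0.
case/negP: nh; case/and3P: h1 => /eqP a1 /eqP a2 /eqP a3.
case/and3P: h2 => /eqP b1 /eqP b2 /eqP b3.
by rewrite /chain3 a1 a2 b1 b2 b3 a3 !eqxx.
Qed.

(** d (d x_t) is the difference of the two bracketings of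
sum x_r x_s x_w over the threefold factorisations of [t]. *)
Lemma gl_jacobi t f : mulddx par sc t f = 0.
Proof.
rewrite /mulddx sum_ce_coef => [|r s]; last first.
  rewrite scalerDr addrC scalerA.
  rewrite (muldx_mulx struct_const_par r s) (muldx_mulx struct_const_par s r).
  rewrite !scalerA; congr (_ *: _ + _ *: _).
    rewrite /swap_sign /par_sign.
    by case: (par r); case: (par s); rewrite /= ?expr0 ?expr1; ring.
  rewrite /swap_sign /par_sign.
  by case: (par r); case: (par s); rewrite /= ?expr0 ?expr1; ring.
pose G r s w : F := X r (X s (X w f)).
transitivity (\sum_r \sum_s gl_coef r s t *:
    (\sum_r1 \sum_r2 gl_coef r1 r2 r *: G r1 r2 s) -
  \sum_r \sum_s (gl_coef r s t * (-1) ^+ par r) *: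
    (\sum_s1 \sum_s2 gl_coef s1 s2 s *: G r s1 s2)).
  rewrite -sumrB; apply: eq_bigr => r _; rewrite -sumrB; apply: eq_bigr => s _.
  rewrite !muldx_gl scalerDr scalerA; congr (_ + _).
  have -> : par_sign k par r = - (-1) ^+ par r by rewrite /par_sign signrN.
  rewrite mulrN scaleNr linear_sum; congr (- (_ *: _)); apply: eq_bigr => s1 _.
  rewrite linear_sum; apply: eq_bigr => s2 _.
  by rewrite linearZ.
apply/eqP; rewrite subr_eq0; apply/eqP.
transitivity (\sum_r \sum_s \sum_w (\sum_q gl_coef q w t * gl_coef r s q) *: G r s w).
  under eq_bigr do under eq_bigr do rewrite scaler_sumr.
  under eq_bigr do rewrite exchange_big /=.
  rewrite exchange_big /=; apply: eq_bigr => r _.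
  under eq_bigr do under eq_bigr do rewrite scaler_sumr.
  under eq_bigr do rewrite exchange_big /=.
  rewrite exchange_big /=; apply: eq_bigr => s _.
  rewrite exchange_big /=; apply: eq_bigr => w _.
  by rewrite scaler_suml; apply: eq_bigr => q _; rewrite scalerA.
apply: eq_bigr => r _.
transitivity (\sum_s \sum_w
  (\sum_q gl_coef r q t * (-1) ^+ par r * gl_coef s w q) *: G r s w).
  apply: eq_bigr => s _; apply: eq_bigr => w _.
  by rewrite gl_coef_assocl gl_coef_assocr.
under [RHS]eq_bigr do rewrite scaler_sumr.
rewrite [RHS]exchange_big /=; apply: eq_bigr => s _.
under [RHS]eq_bigr do rewrite scaler_sumr.
rewrite [RHS]exchange_big /=; apply: eq_bigr => w _.
by rewrite scaler_suml; apply: eq_bigr => q _; rewrite scalerA.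
Qed.

Lemma gl_ce_diff_sq u : admissible par u ->
  ce_diff par sc (ce_diff par sc (basis_cochain k u)) = 0.
Proof.
by apply: ce_diff_sq_basis => [|t f _]; [apply: struct_const_par|apply: gl_jacobi].
Qed.

End GlJacobi.

(** * Euler characteristic of the cohomology and of the cochains *)

Section EulerPoincare.

Variables (k : fieldType) (I : finType) (par : I -> bool).
Variables (c : I -> I -> I -> k) (n : nat) (wt : I -> 'rV[int]_n).

Hypothesis c_par : forall r s t, c r s t != 0 -> par r (+) par s = par t.
Hypothesis c_wt : forall r s t, c r s t != 0 -> wt r + wt s = wt t.
Hypothesis ce_diff_sq : forall u, admissible par u ->
  ce_diff par c (ce_diff par c (basis_cochain k u)) = 0.

Local Notation F := ({ffun I -> nat} -> k^o).
Local Notation d := (ce_diff par c).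

Implicit Types (r s t : I) (u v w : {ffun I -> nat}) (f g : F).
Implicit Types (p : nat) (eps : bool) (lam : 'rV[int]_n).

Lemma degree_incr r u : degree (incr r u) = (degree u).+1.
Proof.
rewrite /degree (bigD1 r) //= [in RHS](bigD1 r) //= incrE eqxx addn1 addSn.
by congr (_ + _).+1; apply: eq_bigr => s /negPf sr; rewrite incrE sr addn0.
Qed.

Lemma parity_incr r u : parity par (incr r u) = par r (+) parity par u.
Proof.
rewrite /parity; have [pr|pr] := boolP (par r).
  rewrite (bigD1 r) //= [in RHS](bigD1 r) //= incrE eqxx addn1 addSn /=.
  by congr (~~ odd (_ + _)); apply: eq_bigr => s /andP[_ /negPf sr];
     rewrite incrE sr addn0.
congr odd; apply: eq_bigr => s ps; rewrite incrE; case: eqP => [sr|].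
  by rewrite sr (negPf pr) in ps.
by rewrite addn0.
Qed.

Lemma weight_incr r u : weight wt (incr r u) = wt r + weight wt u.
Proof.
rewrite /weight (bigD1 r) //= [in RHS](bigD1 r) //= incrE eqxx addn1 mulrS addrA.
by congr (_ + _); apply: eq_bigr => s /negPf sr; rewrite incrE sr addn0.
Qed.

Lemma monomial_of_exponent p eps lam u :
  admissible par u -> degree u = p -> parity par u = eps -> weight wt u = lam ->
  exists m : monomial par wt p eps lam, expo (val m) = u.
Proof.
move=> au du pu wu; pose m : {ffun I -> 'I_p.+1} := [ffun r => inord (u r)].
have mE : expo m = u.
  apply/ffunP => r; rewrite !ffunE inordK // ltnS -du /degree (bigD1 r) //=.
  exact: leq_addr.
have hm : is_monomial par wt eps lam m.
  by rewrite /is_monomial mE au du pu wu !eqxx.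
by exists (exist _ m hm).
Qed.

Lemma expo_inj p : injective (@expo I p).
Proof.
move=> m m' /ffunP h; apply/ffunP => r; apply/val_inj.
by move: (h r); rewrite !ffunE.
Qed.

Lemma formalE p eps lam (f : cochain k par wt p eps lam) :
  formal f = \sum_m f m *: basis_cochain k (expo (val m)).
Proof.
apply/funext => u; rewrite /formal fct_sumE big_mkcond; apply: eq_bigr => m _.
rewrite scalefE /basis_cochain eq_sym.
by case: eqP => _; rewrite ?mulr1 ?mulr0.
Qed.

(** A monomial occurring in d x^v arises from x^v by replacing a factor x_t by
x_r x_s, for a nonzero structure constant: this is how d controls degree, parity
and weight. *)
Lemma ce_diff_support f u : d f u != 0 -> exists r s t w,
  [/\ admissible par u, c r s t != 0, u = incr r (incr s w) & f (incr t w) != 0].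
Proof.
rewrite /ce_diff => h.
have : exists t r s, - 2^-1 * (-1) ^+ (par r && ~~ par s) * c r s t *
    mulx par r (mulx par s (derx par t f)) u != 0.
  apply: contrapT => hn; move/eqP: h; apply.
  apply: big1 => t _; apply: big1 => r _; apply: big1 => s _.
  by apply/eqP; apply: contrapT => /negP h; apply: hn; exists t, r, s.
case=> t [r [s]]; rewrite mulf_eq0 => /norP[]; rewrite mulf_eq0 => /norP[_ hc].
have [u0|[v ->]] := incr_cases r u; first by rewrite mulx0 ?eqxx.
rewrite mulx_incr; case: ifP => [au|]; last by rewrite eqxx.
rewrite mulf_eq0 => /norP[_].
have [v0|[w vE]] := incr_cases s v; first by rewrite mulx0 ?eqxx.
rewrite vE mulx_incr; case: ifP => [av|]; last by rewrite eqxx.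
rewrite mulf_eq0 => /norP[_]; rewrite /derx mulf_eq0 => /norP[_ hf].
by exists r, s, t, w; split; rewrite // -vE.
Qed.

(** Restricting [ce_diff] to the monomials of degree [p.+1] loses nothing, so
that the finite-dimensional maps compose like the formal operator. *)
Lemma formal_diff p eps lam (f : cochain k par wt p eps lam) :
  formal (diff_fun c f) = d (formal f).
Proof.
apply/funext => u; rewrite /formal.
have [[m mE]|nm] :=
    pselect (exists m : monomial par wt p.+1 eps lam, expo (val m) = u).
  rewrite (bigD1 m) /= ?mE // big1 ?addr0 => [|m' /andP[/eqP h nm]].
    by rewrite ffunE mE.
  case/negP: nm; apply/eqP/val_inj/expo_inj; rewrite -h; exact: esym.
rewrite big1 => [|m /eqP mE]; last by case: nm; exists m.
apply/esym/eqP; apply: contrapT => /negP /ce_diff_support.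
move=> [r [s [t [w [au crst uE]]]]]; rewrite /formal => hf.
apply: nm.
have [m hm] : exists m : monomial par wt p eps lam, incr t w = expo (val m).
  apply: contrapT => hn; move/eqP: hf; apply.
  by rewrite big1 // => m /eqP h; case: hn; exists m.
have /and4P[_ /eqP dm /eqP pm /eqP wm] := valP m.
move: dm pm wm; rewrite -hm degree_incr parity_incr weight_incr => dm pm wm.
apply: monomial_of_exponent; rewrite // uE.
- by rewrite !degree_incr dm.
- by rewrite !parity_incr addbA (c_par crst).
- by rewrite !weight_incr addrA (c_wt crst).
Qed.

Lemma diff_diff p eps lam (f : cochain k par wt p eps lam) :
  diff par c wt p.+1 eps lam (diff par c wt p eps lam f) = 0.
Proof.
rewrite !diffE; apply/ffunP => m; rewrite ffunE formal_diff formalE.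
rewrite linear_sum linear_sum fct_sumE ffunE big1 // => m' _.
rewrite linearZ /= linearZ /= ce_diff_sq ?scaler0 //.
by case/and4P: (valP m').
Qed.

Lemma dim_cochain p eps lam :
  \dim {: cochain k par wt p eps lam} = #|monomial par wt p eps lam|.
Proof. by rewrite dimvf /dim /= muln1. Qed.

Lemma coboundaries_sub p eps lam :
  (coboundaries par c wt p eps lam <= cocycles par c wt p eps lam)%VS.
Proof.
case: p => [|p]; first exact: sub0v.
apply/subvP => _ /memv_imgP[f _ ->].
by rewrite memv_ker diff_diff.
Qed.

(** Rank-nullity for the differential out of degree [p], with the
representation of the quotient by a complement, whose dimension is right because
coboundaries are cocycles. *)
Lemma dim_cohomology p eps lam :
  (\dim (cohomology par c wt p eps lam) +
   \dim (coboundaries par c wt p eps lam) +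
   \dim (coboundaries par c wt p.+1 eps lam))%N =
  #|monomial par wt p eps lam|.
Proof.
have dimH : (\dim (cohomology par c wt p eps lam) +
     \dim (coboundaries par c wt p eps lam))%N =
    \dim (cocycles par c wt p eps lam).
  rewrite -(dimv_cap_compl (cocycles par c wt p eps lam)
    (coboundaries par c wt p eps lam)) addnC; congr (_ + _)%N.
  by rewrite capvC (capv_idPl (coboundaries_sub _ _ _)).
by rewrite dimH -dim_cochain -(limg_ker_dim (diff par c wt p eps lam) fullv) capfv.
Qed.

(** Telescoping: each space of coboundaries contributes to two consecutive
degrees with opposite signs, and the last one vanishes for lack of cochains. *)
Lemma euler_char_uptoE P lam :
  (forall eps, #|monomial par wt P.+1 eps lam| = 0%N) ->
  euler_char_upto par c wt P lam =
  \sum_(p < P.+1) \sum_(eps : bool)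
    (-1) ^+ (p + eps) * #|monomial par wt p eps lam|%:Z.
Proof.
move=> h0; rewrite /euler_char_upto exchange_big [RHS]exchange_big /=.
apply: eq_bigr => eps _; apply/eqP; rewrite eq_sym -subr_eq0 -sumrB; apply/eqP.
pose b p := (\dim (coboundaries par c wt p eps lam))%:Z.
have step p : (-1) ^+ (p + eps) * #|monomial par wt p eps lam|%:Z -
    (-1) ^+ (p + eps) * (\dim (cohomology par c wt p eps lam))%:Z =
    (-1) ^+ (p + eps) * b p - (-1) ^+ (p.+1 + eps) * b p.+1 :> int.
  by rewrite -(dim_cohomology p) !PoszD /b addSn exprS; ring.
under eq_bigr do rewrite step.
rewrite -(big_mkord xpredT (fun p => (-1) ^+ (p + eps) * b p -
   (-1) ^+ (p.+1 + eps) * b p.+1)) /=.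
rewrite (telescope_sumr_eq (fun p => - ((-1) ^+ (p + eps) * b p))) //=; last first.
  by move=> p _; rewrite opprK addrC.
have -> : b 0%N = 0 by rewrite /b /= dimv0.
suff -> : b P.+1 = 0 by rewrite !mulr0 !subr0 oppr0.
apply/eqP; rewrite /b -[0]/(0%:Z) eqz_nat -leqn0 -(h0 eps) -dim_cochain dimvS //.
exact: subvf.
Qed.

End EulerPoincare.

(** * Signed count of monomials *)

Section SignedCount.

Variables (I : finType) (par : I -> bool) (n : nat) (wt : I -> 'rV[int]_n).

(** This has the same parity as the degree plus the internal parity, since
polynomial generators count twice there. *)
Definition odd_degree (u : {ffun I -> nat}) := (\sum_(r | ~~ par r) u r)%N.

(** The bound [B] on exponents keeps the sum finite; for weights in the range of
interest all monomials satisfy it. *)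
Definition signed_count (B : nat) (lam : 'rV[int]_n) : int :=
  \sum_(u : {ffun I -> 'I_B.+1} |
    admissible par (expo u) && (weight wt (expo u) == lam))
    (-1) ^+ odd_degree (expo u).

Lemma card_monomial B p eps lam : (p <= B)%N ->
  #|monomial par wt p eps lam| =
  #|[set u : {ffun I -> 'I_B.+1} | [&& admissible par (expo u),
     degree (expo u) == p, parity par (expo u) == eps &
     weight wt (expo u) == lam]]|.
Proof.
move=> le_pB.
pose h (m : monomial par wt p eps lam) : {ffun I -> 'I_B.+1} :=
  [ffun r => inord (val m r)].
have hE m : expo (h m) = expo (val m).
  apply/ffunP => r; rewrite !ffunE inordK // ltnS.
  by apply: leq_trans le_pB; rewrite -ltnS.
have h_inj : injective h.
  move=> m m' hm; apply/val_inj/expo_inj.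
  by rewrite -[LHS]hE hm; apply: hE.
rewrite -cardsT -(card_imset _ h_inj); apply: eq_card => u.
rewrite !inE; apply/imsetP/idP => [[m _ ->]|].
  by rewrite hE; have := valP m.
case/and4P=> au /eqP du /eqP pu /eqP wu.
have [m mE] := monomial_of_exponent au du pu wu.
by exists m => //; apply/expo_inj; rewrite hE.
Qed.

Lemma signed_countE B lam :
  (forall p eps, (B < p)%N -> #|monomial par wt p eps lam| = 0%N) ->
  signed_count B lam =
  \sum_(p < B.+1) \sum_(eps : bool)
    (-1) ^+ (p + eps) * #|monomial par wt p eps lam|%:Z.
Proof.
move=> h0; rewrite /signed_count.
have degB (u : {ffun I -> 'I_B.+1}) : admissible par (expo u) ->
    weight wt (expo u) = lam -> (degree (expo u) <= B)%N.
  move=> au wu; rewrite leqNgt; apply/negP => lt.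
  have [m _] := monomial_of_exponent au (erefl _) (erefl _) wu.
  by have := fintype0 m (h0 _ _ lt).
rewrite (partition_big (fun u : {ffun I -> 'I_B.+1} =>
  inord (degree (expo u)) : 'I_B.+1) xpredT) //=.
apply: eq_bigr => p _.
rewrite (partition_big (fun u : {ffun I -> 'I_B.+1} => parity par (expo u))
  xpredT) //=.
apply: eq_bigr => eps _.
rewrite (card_monomial eps lam (leq_ord p)) mulrC -natz mulr_natl -sumr_const.
have condE (u : {ffun I -> 'I_B.+1}) :
    (admissible par (expo u) && (weight wt (expo u) == lam) &&
      (inord (degree (expo u)) == p)) && (parity par (expo u) == eps) =
    (u \in [set u : {ffun I -> 'I_B.+1} | [&& admissible par (expo u),
     degree (expo u) == p, parity par (expo u) == eps &
     weight wt (expo u) == lam]]).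
  rewrite inE; case: (boolP (admissible _ _)) => //= au.
  case: eqP => [wu|_] /=; last by rewrite !andbF.
  by rewrite -val_eqE /= inordK ?ltnS ?degB // andbT.
apply: eq_big => // u; rewrite condE inE => /and4P[_ /eqP <- /eqP <- _].
rewrite -signr_odd -[RHS]signr_odd /degree (bigID par) /= !oddD /parity.
by rewrite oddb addbAC addbb.
Qed.

End SignedCount.

Section EulerCount.

Variables (k : fieldType) (N : nat) (pi : 'S_(N + N)).
Hypothesis two_neq0 : 2 != 0 :> k.

Lemma struct_const_wt (r s t : Defs.root pi) :
  struct_const k r s t != 0 -> root_wt r + root_wt s = root_wt t.
Proof.
have chain_wt (r' s' : Defs.root pi) : chain r' s' t ->
    root_wt r' + root_wt s' = root_wt t.
  case/and3P=> /eqP h1 /eqP h2 /eqP h3.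
  by rewrite /root_wt /alpha h1 h2 h3 addrA subrK.
rewrite struct_constE; have [h _|_] := boolP (chain s r t).
  by rewrite addrC chain_wt.
have [h _|_] := boolP (chain r s t); first exact: chain_wt.
by rewrite mulr0 subr0 eqxx.
Qed.

Lemma euler_charE (B : nat) lam : (deg_bound pi lam <= B)%N ->
  euler_char k pi lam = signed_count (@root_par N pi) (@root_wt N pi) B lam.
Proof.
move=> le_B.
rewrite signed_countE => [|p eps lt_p]; last first.
  by apply: cochain_deg_bound; apply: leq_ltn_trans lt_p.
rewrite /euler_char (euler_char_uptoE (@struct_const_par k N pi)
  struct_const_wt (@gl_ce_diff_sq k N pi two_neq0)); last first.
  by move=> eps; apply: cochain_deg_bound.
rewrite (big_ord_widen B.+1 (fun p : nat => \sum_(eps : bool) (-1) ^+ (p + eps) *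
  #|monomial (@root_par N pi) (@root_wt N pi) p eps lam|%:Z)) //.
rewrite big_mkcond; apply: eq_bigr => p _ /=; case: ltnP => // lt_p.
by rewrite big1 // => eps _; rewrite cochain_deg_bound // mulr0.
Qed.

End EulerCount.

(** * Laurent polynomials as operators on functions *)

Section ShiftOperators.

Variable V : zmodType.

Local Notation M := (V -> int).

Implicit Types (f g : M) (v w : V).

Definition shift v f : M := fun w => f (w - v).

Definition commutes_with_shifts (Q : M -> M) :=
  {morph Q : f g / f - g} /\ forall v f, Q (shift v f) = shift v (Q f).

(** The bicommutant of the shifts among additive operators on functions on V.
It contains the shifts and is a commutative ring, so that the Laurent
polynomials in the shifts can be manipulated by ring identities, while each of
them still acts on arbitrary functions, in particular on the coefficients of
infinite series. Multiplication is composition, and its commutativity holds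
because the elements of a bicommutant commute with the shifts
([shift_op_shift]) hence with each other. *)
Record shift_op := ShiftOp {
  shift_op_fun :> M -> M;
  shift_op_sub : {morph shift_op_fun : f g / f - g};
  shift_op_comm : forall Q, commutes_with_shifts Q ->
    forall f, shift_op_fun (Q f) = Q (shift_op_fun f) }.

Implicit Types a b : shift_op.

Lemma shift_op_eq a b : (forall f, a f = b f) -> a = b.
Proof.
case: a b => [P P1 P2] [Q Q1 Q2] /= h.
have {h} PQ : P = Q by apply/funext.
case: Q / PQ Q1 Q2 => Q1 Q2.
by rewrite (Prop_irrelevance P1 Q1) (Prop_irrelevance P2 Q2).
Qed.

Lemma shift_op_shift a : commutes_with_shifts a.
Proof.
split=> [|v f]; first exact: shift_op_sub.
by apply: shift_op_comm; split=> [g h|w g]; apply/funext => u //=;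
  rewrite /shift addrAC.
Qed.

Lemma shift_op0 a : a 0 = 0.
Proof. by have := shift_op_sub a 0 0; rewrite !subrr. Qed.

Lemma shift_opN a f : a (- f) = - a f.
Proof. by rewrite -[- f]sub0r shift_op_sub shift_op0 sub0r. Qed.

Lemma shift_opD a f g : a (f + g) = a f + a g.
Proof. by rewrite -{1}[g]opprK shift_op_sub shift_opN opprK. Qed.

Lemma commutes_sub Q f g : commutes_with_shifts Q -> Q (f - g) = Q f - Q g.
Proof. by case. Qed.

Lemma commutes_opp Q f : commutes_with_shifts Q -> Q (- f) = - Q f.
Proof.
move=> hQ; have Q0 : Q 0 = 0 by have := commutes_sub 0 0 hQ; rewrite !subrr.
by rewrite -[- f]sub0r (commutes_sub _ _ hQ) Q0 sub0r.
Qed.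

Lemma commutes_add Q f g : commutes_with_shifts Q -> Q (f + g) = Q f + Q g.
Proof.
by move=> hQ; rewrite -{1}[g]opprK (commutes_sub _ _ hQ) (commutes_opp _ hQ) opprK.
Qed.

Program Definition sop_zero := @ShiftOp (fun=> 0) _ _.
Next Obligation. by move=> f g; rewrite subr0. Qed.
Next Obligation. move=> Q H f /=. by have := commutes_sub 0 0 H; rewrite !subrr. Qed.

Program Definition sop_opp a := @ShiftOp (fun f => - a f) _ _.
Next Obligation. by move=> a f g /=; rewrite shift_op_sub opprD. Qed.
Next Obligation. move=> a Q H f /=. by rewrite (commutes_opp _ H) (shift_op_comm _ H). Qed.

Program Definition sop_add a b := @ShiftOp (fun f => a f + b f) _ _.
Next Obligation.
by move=> a b f g /=; rewrite !shift_op_sub opprD addrACA.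
Qed.
Next Obligation. move=> a b Q H f /=. by rewrite (commutes_add _ _ H) !(shift_op_comm _ H). Qed.

Definition sop_one :=
  @ShiftOp id (fun f g => erefl) (fun Q _ f => erefl).

Program Definition sop_mul a b := @ShiftOp (fun f => a (b f)) _ _.
Next Obligation. by move=> a b f g /=; rewrite !shift_op_sub. Qed.
Next Obligation. move=> a b Q H f /=. by rewrite !(shift_op_comm _ H). Qed.

Fact shift_sub v : {morph shift v : f g / f - g}.
Proof. by []. Qed.

Fact shift_comm v Q : commutes_with_shifts Q ->
  forall f, shift v (Q f) = Q (shift v f).
Proof. by move=> [_ hQ] f; rewrite hQ. Qed.

(** The monomial s^v. *)
Definition mono v := ShiftOp (shift_sub v) (@shift_comm v).

HB.instance Definition _ := gen_eqMixin shift_op.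
HB.instance Definition _ := gen_choiceMixin shift_op.

Fact sop_addA : associative sop_add.
Proof. by move=> a b c; apply: shift_op_eq => f /=; rewrite addrA. Qed.
Fact sop_addC : commutative sop_add.
Proof. by move=> a b; apply: shift_op_eq => f /=; rewrite addrC. Qed.
Fact sop_add0 : left_id sop_zero sop_add.
Proof. by move=> a; apply: shift_op_eq => f /=; rewrite add0r. Qed.
Fact sop_addN : left_inverse sop_zero sop_opp sop_add.
Proof. by move=> a; apply: shift_op_eq => f /=; rewrite addNr. Qed.

HB.instance Definition _ :=
  GRing.isZmodule.Build shift_op sop_addA sop_addC sop_add0 sop_addN.

Fact sop_mulA : associative sop_mul.
Proof. by move=> a b c; apply: shift_op_eq. Qed.
Fact sop_mulC : commutative sop_mul.
Proof.
move=> a b; apply: shift_op_eq => f /=.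
by apply: shift_op_comm; apply: shift_op_shift.
Qed.
Fact sop_mul1 : left_id sop_one sop_mul.
Proof. by move=> a; apply: shift_op_eq. Qed.
Fact sop_mulDl : left_distributive sop_mul sop_add.
Proof. by move=> a b c; apply: shift_op_eq. Qed.
Fact sop_one_neq0 : sop_one != 0.
Proof.
by apply/eqP => /(congr1 (fun a : shift_op => a (fun=> 1) 0)).
Qed.

HB.instance Definition _ := GRing.Zmodule_isComNzRing.Build shift_op
  sop_mulA sop_mulC sop_mul1 sop_mulDl sop_one_neq0.

Lemma sop0E f : (0 : shift_op) f = 0. Proof. by []. Qed.
Lemma sopDE a b f : (a + b) f = a f + b f. Proof. by []. Qed.
Lemma sopBE a b f : (a - b) f = a f - b f. Proof. by []. Qed.
Lemma sop1E f : (1 : shift_op) f = f. Proof. by []. Qed.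
Lemma sopME a b f : (a * b) f = a (b f). Proof. by []. Qed.

Lemma sop_sumE (J : Type) (r : seq J) (P : pred J) (F : J -> shift_op) f :
  (\sum_(j <- r | P j) F j) f = \sum_(j <- r | P j) F j f.
Proof.
exact: (big_morph (fun a : shift_op => a f) (fun a b => sopDE a b f) (sop0E f)).
Qed.

Lemma shift_op_sumr (J : Type) (r : seq J) (P : pred J) (F : J -> M) a :
  a (\sum_(j <- r | P j) F j) = \sum_(j <- r | P j) a (F j).
Proof. exact: (big_morph a (shift_opD a) (shift_op0 a)). Qed.

Lemma sop_signE (n : nat) a f w : ((-1) ^+ n * a) f w = (-1) ^+ n * a f w.
Proof.
by rewrite -signr_odd -[in RHS]signr_odd !mulr_sign; case: (odd n).
Qed.

Lemma mono0 : mono 0 = 1.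
Proof. by apply: shift_op_eq => f; apply/funext => w /=; rewrite /shift subr0. Qed.

Lemma monoD v w : mono (v + w) = mono v * mono w.
Proof.
apply: shift_op_eq => f; apply/funext => u.
by rewrite sopME /= /shift opprD addrA.
Qed.

Lemma mono_sum (J : Type) (r : seq J) (P : pred J) (F : J -> V) :
  mono (\sum_(j <- r | P j) F j) = \prod_(j <- r | P j) mono (F j).
Proof. exact: (big_morph mono monoD mono0). Qed.

Lemma monoMn v n : mono (v *+ n) = mono v ^+ n.
Proof. by elim: n => [|n IH]; rewrite ?mono0 // mulrS exprS monoD IH. Qed.

(** The series 1. *)
Definition dirac : M := fun w => (w == 0)%:R.

Section HalfSpace.

Variable lev : {additive V -> int}.

(** Series expanded in a half-space where the level is bounded below. *)
Definition half_supported f := exists c : int, forall w, f w != 0 -> c <= lev w.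

(** Operators by which equations between half-supported series can be
cancelled. *)
Definition regular a :=
  (forall f, half_supported f -> half_supported (a f)) /\
  (forall f, half_supported f -> a f = 0 -> f = 0).

Lemma half_supportedD f g :
  half_supported f -> half_supported g -> half_supported (f + g).
Proof.
move=> [c hc] [c' hc']; exists (Num.min c c') => w.
have [fw|/hc h _] := eqVneq (f w) 0; last by rewrite ge_min h.
have -> : (f + g) w = g w by rewrite -[RHS]add0r -fw.
by move=> /hc' h; rewrite ge_min h orbT.
Qed.

Lemma half_supportedN f : half_supported f -> half_supported (- f).
Proof. by move=> [c hc]; exists c => w; rewrite oppr_eq0; apply: hc. Qed.

Lemma half_supported_mono v f : half_supported f -> half_supported (mono v f).
Proof.
move=> [c hc]; exists (c + lev v) => w /= /hc.
by rewrite raddfB /= lerBrDr.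
Qed.

Lemma regularM a b : regular a -> regular b -> regular (a * b).
Proof.
move=> [a1 a2] [b1 b2]; split=> f hf; first by apply: a1; apply: b1.
by move=> h; apply: b2 => //; apply: a2 => //; apply: b1.
Qed.

Lemma regular1 : regular 1.
Proof. by split. Qed.

Lemma regular_prod (J : Type) (r : seq J) (P : pred J) (F : J -> shift_op) :
  (forall j, P j -> regular (F j)) -> regular (\prod_(j <- r | P j) F j).
Proof.
move=> hF; elim/big_rec: _ => [|j a Pj ha]; first exact: regular1.
by apply: regularM => //; apply: hF.
Qed.

Lemma regular_eq a f g : regular a -> half_supported f -> half_supported g ->
  a f = a g -> f = g.
Proof.
move=> [_ inj] hf hg hfg; apply/eqP; rewrite -subr_eq0; apply/eqP.
apply: inj; last by rewrite shift_op_sub hfg subrr.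
by apply: half_supportedD => //; apply: half_supportedN.
Qed.

Lemma regular_mono v : regular (mono v).
Proof.
split=> [f|f _ h]; first exact: half_supported_mono.
have : mono (- v) (mono v f) = 0 by rewrite h shift_op0.
by rewrite -sopME -monoD addNr mono0.
Qed.

(** A function killed by T_v - T_w is invariant under v - w. If v - w has a
nonzero level, the translates of a point of the support go down to arbitrarily
low levels. *)
Lemma regular_mono_sub v w : lev v != lev w -> regular (mono v - mono w).
Proof.
move=> vw; split=> [f hf|f [c hc] h].
  by apply: half_supportedD; [|apply: half_supportedN]; apply: half_supported_mono.
have per1 u : f u = f (u + (v - w)).
  have : f (u + v - v) - f (u + v - w) = 0 := congr1 (fun g => g (u + v)) h.
  by rewrite addrK -addrA => /eqP; rewrite subr_eq0 => /eqP.
have per u (n : nat) : f u = f (u + (v - w) *+ n) /\ f u = f (u - (v - w) *+ n).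
  elim: n => [|n [IH1 IH2]]; first by rewrite mulr0n addr0 subr0.
  split; first by rewrite IH1 per1 mulrSr (addrA u).
  by rewrite IH2 [RHS]per1 mulrSr (opprD (_ *+ n)) (addrA u) subrK.
apply/funext => u; apply/eqP; apply: contraT => fu.
(* K steps of nonzero level suffice to pass below c in one direction. *)
pose K := `|lev u - c|.+1; have [h1 h2] := per u K.
have := hc (u + (v - w) *+ K); rewrite -h1 => /(_ fu).
have := hc (u - (v - w) *+ K); rewrite -h2 => /(_ fu).
rewrite !raddfB raddfD raddfMn !raddfB /= -mulr_natr natz.
set D := lev v - lev w; have D0 : D != 0 by rewrite subr_eq0.
have {h1 h2} : D * K <= - K%:Z \/ K%:Z <= D * K by nia.
rewrite /K; set z := D * _; move: z (lev u) => z L h1 h2 h3; exfalso; lia.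
Qed.

End HalfSpace.

End ShiftOperators.

Arguments dirac {V}.

(** * The product formula for the generating series *)

Section GeneratingFunction.

Variables (I : finType) (par : I -> bool) (n : nat).
Local Notation V := 'rV[int]_n.
Variables (wt : I -> V) (lev : {additive V -> int}).
Hypothesis wt_gt0 : forall r, 0 < lev (wt r).

Local Notation A := (shift_op V).
Implicit Types (f g : V -> int) (a b : A) (B : nat).

(** A geometric series is cut at exponent [B], which does not change the
coefficients at levels at most [B]. *)
Definition truncated_factor B r : A :=
  if par r then \sum_(m < B.+1) mono (wt r *+ m) else 1 - mono (wt r).

(** Expanding the product chooses one exponent for each generator. The
condition on [B] leaves room for exponent 1 of the exterior generators. *)
Lemma signed_count_truncated_product B lam : (0 < B)%N ->
  signed_count par wt B lam = (\prod_r truncated_factor B r) dirac lam.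
Proof.
case: B => // B _.
pose term r (m : 'I_B.+2) : A :=
  if par r || (m <= 1)%N then (-1) ^+ (~~ par r * m) * mono (wt r *+ m) else 0.
have factorE r : truncated_factor B.+1 r = \sum_m term r m.
  rewrite /truncated_factor /term; case: (par r) => /=.
    by apply: eq_bigr => m _; rewrite mul0n mul1r.
  rewrite !big_ord_recl /= big1 => [|m _]; last by [].
  by rewrite addr0 mulr0n mono0 mulr1n !mul1n expr0 expr1 mul1r mulN1r.
under eq_bigr do rewrite factorE.
rewrite bigA_distr_bigA /= sop_sumE fct_sumE /signed_count big_mkcond /=.
apply: eq_bigr => u _.
have [au|nu] := boolP (admissible par (expo u)); last first.
  move/forallPn: nu => [r hr]; rewrite ffunE in hr.
  suff -> : \prod_r term r (u r) = 0 by [].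
  by rewrite (bigD1 r) //= /term (negPf hr) mul0r.
have -> : \prod_r term r (u r) = (-1) ^+ odd_degree par (expo u) *
    mono (weight wt (expo u)).
  rewrite /odd_degree /weight mono_sum [X in _ ^+ X]big_mkcond /=.
  rewrite (big_morph _ (exprD (-1)) (expr0 (-1))) -big_split /=.
  apply: eq_bigr => r _; rewrite /term ffunE.
  have -> : par r || (u r <= 1)%N by move/forallP: au => /(_ r); rewrite ffunE.
  by case: (par r); rewrite /= ?mul0n ?mul1n.
rewrite sop_signE /= /shift /dirac subr_eq0 eq_sym.
by case: eqP => _; rewrite ?mulr1 ?mulr0.
Qed.

Lemma weight_lev_ge0 (u : {ffun I -> nat}) : 0 <= lev (weight wt u).
Proof.
rewrite /weight raddf_sum; apply: sumr_ge0 => r _.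
by rewrite raddfMn mulrn_wge0 // ltW.
Qed.

Lemma signed_count_lev_lt0 B lam : lev lam < 0 -> signed_count par wt B lam = 0.
Proof.
move=> lt0; rewrite /signed_count big1 // => u /andP[_ /eqP wu].
by have := weight_lev_ge0 (expo u); rewrite wu leNgt lt0.
Qed.

Definition agree_upto (B : int) f g := forall w, lev w <= B -> f w = g w.

(** Operators that do not bring high levels down: truncated computations are
preserved by them. *)
Definition local_upto (B : int) a :=
  forall f g, agree_upto B f g -> agree_upto B (a f) (a g).

Lemma local_uptoM B a b : local_upto B a -> local_upto B b -> local_upto B (a * b).
Proof. by move=> ha hb f g /hb /ha. Qed.

Lemma local_upto1 B : local_upto B 1.
Proof. by []. Qed.

Lemma local_upto_one_sub_mono (B : int) v : 0 <= lev v -> local_upto B (1 - mono v).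
Proof.
move=> lev_v f g fg w lw; rewrite !sopBE.
suff h : shift v f w = shift v g w by rewrite /= -[LHS]/(_ - _) -[RHS]/(_ - _) h fg.
by apply: fg; rewrite raddfB /=; apply: le_trans lw; rewrite gerBl.
Qed.

Lemma local_upto_prod B (J : Type) (s : seq J) (P : pred J) (F : J -> A) :
  (forall j, P j -> local_upto B (F j)) -> local_upto B (\prod_(j <- s | P j) F j).
Proof.
move=> hF; elim/big_rec: _ => [|j a Pj ha]; first exact: local_upto1.
by apply: local_uptoM => //; apply: hF.
Qed.

Definition exterior_part : V -> int :=
  (\prod_(r | ~~ par r) (1 - mono (wt r))) dirac.

Lemma exterior_part_lev_lt0 w : lev w < 0 -> exterior_part w = 0.
Proof.
rewrite /exterior_part; elim/big_rec: _ w => [|r a _ IH] w lw.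
  rewrite sop1E /dirac; case: eqP => // w0; move: lw.
  by rewrite w0 raddf0 ltxx.
rewrite sopME sopBE; set g := a _ in IH *.
rewrite -[LHS]/(g w - g (w - wt r)) !IH ?subr0 // raddfB /= subr_lt0.
by apply: lt_trans (wt_gt0 r).
Qed.

(** Cleared of denominators, the product formula reads
prod (1 - s^alpha) c = prod (1 - s^beta), with alpha and beta running over the
polynomial and the exterior weights. At a given point, c may be replaced
by the truncated product, where (1 - s^alpha) (1 + ... + s^(B alpha)) is
1 - s^((B+1) alpha), and the last term acts only above level [B]. *)
Lemma generating_function (c : V -> int) :
  (forall B lam, (0 < B)%N -> `|lev lam| <= B -> c lam = signed_count par wt B lam) ->
  (\prod_(r | par r) (1 - mono (wt r))) c = exterior_part /\ half_supported lev c.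
Proof.
move=> cE; have c0 lam : lev lam < 0 -> c lam = 0.
  move=> lt0; rewrite (cE `|lev lam|%N.+1) ?signed_count_lev_lt0 //.
  by move: (lev lam) => z; lia.
split; last first.
  by exists 0 => w; case: ltP => // /c0 ->; rewrite eqxx.
apply/funext => lam; pose B := `|lev lam|%N.+1.
have levB : lev lam <= B%:Z by rewrite /B; move: (lev lam) => z; lia.
have cB : agree_upto B%:Z c ((\prod_r truncated_factor B r) dirac).
  move=> w lw; rewrite -signed_count_truncated_product //; case: (ltP (lev w) 0) => h.
    by rewrite c0 // signed_count_lev_lt0.
  by apply: cE => //; rewrite ger0_norm.
have locP : local_upto B%:Z (\prod_(r | par r) (1 - mono (wt r))).
  by apply: local_upto_prod => r _; apply: local_upto_one_sub_mono; apply: ltW.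
have -> : (\prod_(r | par r) (1 - mono (wt r))) c lam =
    (\prod_(r | par r) (1 - mono (wt r *+ B.+1))) exterior_part lam.
  rewrite (locP _ _ cB) // -!sopME; congr (shift_op_fun _ dirac lam).
  rewrite [X in _ * X](bigID par) /= mulrA -big_split /=; congr (_ * _).
    apply: eq_bigr => r pr; rewrite /truncated_factor pr.
    under eq_bigr do rewrite monoMn.
    by rewrite monoMn -opprB mulNr -subrX1 opprB.
  by apply: eq_bigr => r /negPf pr; rewrite /truncated_factor pr.
suff H : local_upto B%:Z (\prod_(r | par r) (1 - mono (wt r *+ B.+1))) /\
    agree_upto B%:Z ((\prod_(r | par r) (1 - mono (wt r *+ B.+1))) exterior_part)
      exterior_part by apply: H.2.
elim/big_rec: _ => [|r a pr [IH1 IH2]]; first by split.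
have loc : local_upto B%:Z (1 - mono (wt r *+ B.+1)).
  by apply: local_upto_one_sub_mono; rewrite raddfMn mulrn_wge0 // ltW.
split; first exact: local_uptoM.
move=> w lw; rewrite sopME (loc _ _ IH2) //.
rewrite sopBE -[LHS]/(_ - exterior_part (w - wt r *+ B.+1)).
rewrite exterior_part_lev_lt0 ?subr0 //.
rewrite raddfB raddfMn /= -mulr_natr natz.
by move: (lev w) (lev (wt r)) (wt_gt0 r) lw => z d; nia.
Qed.

End GeneratingFunction.

(** * The Cauchy determinant *)

Section Cauchy.

Variables (A : comNzRingType) (N : nat).
Implicit Types x y : 'I_N -> A.

Definition vandermonde_prod x : A :=
  \prod_(i < N) \prod_(j < N | (i < j)%N) (x j - x i).

(** The sign (-1)^(N (N - 1) / 2). *)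
Definition pair_sign : A := \prod_(i < N) \prod_(j < N | (i < j)%N) (-1).

Lemma det_vandermonde x : \det (Vandermonde N (\row_i x i)) = vandermonde_prod x.
Proof.
rewrite det_Vandermonde; apply: eq_bigr => i _; apply: eq_bigr => j _.
by rewrite !mxE.
Qed.

(** The rows of the Cauchy matrix, multiplied by prod_j (y_j - x_i), are the
values of these polynomials at x_i. *)
Definition omit_poly y (j : 'I_N) : {poly A} :=
  \prod_(j' | j' != j) ((y j')%:P - 'X).

Lemma horner_omit_poly y j c : (omit_poly y j).[c] = \prod_(j' | j' != j) (y j' - c).
Proof.
by rewrite /omit_poly horner_prod; apply: eq_bigr => j' _; rewrite !hornerE.
Qed.

Lemma size_omit_poly y j : (size (omit_poly y j) <= N)%N.
Proof.
apply: leq_trans (size_poly_prod_leq _ _) _ => /=.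
have cardE : #|(fun j' : 'I_N => j' != j)| = N.-1.
  by rewrite (cardC1 j) card_ord.
have N_gt0 : (0 < N)%N by apply: leq_ltn_trans (ltn_ord j).
rewrite leq_subLR cardE; apply: leq_ltn_trans (_ : (\sum_(j' | j' != j) 2 < _)%N).
  apply: leq_sum => j' _; rewrite -opprB size_polyN size_XsubC //.
by rewrite sum_nat_const cardE; case: (N) N_gt0 => // n _ /=; lia.
Qed.

Definition omit_mx y : 'M[A]_N := \matrix_(m < N, j < N) (omit_poly y j)`_m.

Lemma vandermonde_omit_mx x y :
  (Vandermonde N (\row_i x i))^T *m omit_mx y =
  \matrix_(i < N, j < N) \prod_(j' | j' != j) (y j' - x i).
Proof.
apply/matrixP => i j; rewrite !mxE -horner_omit_poly.
rewrite (horner_coef_wide _ (size_omit_poly y j)); apply: eq_bigr => m _.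
by rewrite !mxE mulrC.
Qed.

Lemma vandermonde_prod_sqr y :
  \prod_(j < N) \prod_(j' < N | j' != j) (y j' - y j) =
  pair_sign * vandermonde_prod y * vandermonde_prod y.
Proof.
transitivity (\prod_(j < N) (\prod_(j' < N | (j < j')%N) (y j' - y j) *
    \prod_(j' < N | (j' < j)%N) (y j' - y j))).
  apply: eq_bigr => j _; rewrite (bigID (fun j' : 'I_N => (j < j')%N)) /=.
  congr (_ * _); apply: eq_bigl => j'; rewrite -val_eqE /=; by case: ltngtP.
rewrite big_split /= mulrC; congr (_ * _).
rewrite (exchange_big_dep xpredT) //= /pair_sign /vandermonde_prod -big_split /=.
apply: eq_bigr => i _; rewrite -big_split /=; apply: eq_bigr => j _.
by rewrite mulN1r opprB.
Qed.

(** Cauchy's determinant, multiplied by prod_(i, j) (y_j - x_i). The matrix is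
the product of the transposed Vandermonde matrix of [x] by the matrix
[omit_mx y] of coefficients, whose determinant follows from the case
[x = y], where the product is diagonal. This last step would cancel
[vandermonde_prod y], which is kept as a common factor because the ring may have
zero divisors. *)
Lemma cauchy_det x y :
  vandermonde_prod y * \sum_(s : 'S_N) (-1) ^+ s *
    \prod_i \prod_(j | j != s i) (y j - x i) =
  pair_sign * vandermonde_prod x * vandermonde_prod y * vandermonde_prod y.
Proof.
have -> : \sum_(s : 'S_N) (-1) ^+ s * \prod_i \prod_(j | j != s i) (y j - x i) =
    vandermonde_prod x * \det (omit_mx y).
  rewrite -(det_vandermonde x) -det_tr -det_mulmx vandermonde_omit_mx.
  apply: eq_bigr => s _; congr (_ * _); apply: eq_bigr => i _.
  by rewrite !mxE.
rewrite mulrCA; have -> : vandermonde_prod y * \det (omit_mx y) =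
    \prod_(j < N) \prod_(j' < N | j' != j) (y j' - y j).
  rewrite -(det_vandermonde y) -det_tr -det_mulmx vandermonde_omit_mx.
  transitivity (\det (diag_mx (\row_j \prod_(j' < N | j' != j) (y j' - y j)))).
    congr (\det _); apply/matrixP => i j; rewrite !mxE.
    have [->|ij] := eqVneq i j; first by rewrite mulr1n.
    by rewrite mulr0n (bigD1 i) //= subrr mul0r.
  by rewrite det_diag; apply: eq_bigr => j _; rewrite mxE.
by rewrite vandermonde_prod_sqr; ring.
Qed.

End Cauchy.

(** The signature is the sign of the Vandermonde product of the permuted
sequence of integers, hence counts inversions. *)
Lemma sign_inversions (N : nat) (s : 'S_N) :
  (-1) ^+ s = \prod_(i < N) \prod_(j < N | (i < j)%N)
                (if (s i < s j)%N then 1 else -1) :> int.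
Proof.
pose a (i : 'I_N) := (i : nat)%:Z.
have : vandermonde_prod (a \o s) = (-1) ^+ s * vandermonde_prod a.
  rewrite -!det_vandermonde mulrC.
  have -> : Vandermonde N (\row_i (a \o s) i) =
      Vandermonde N (\row_i a i) *m perm_mx s^-1.
    rewrite -col_permE; apply/matrixP => i j; by rewrite !mxE.
  by rewrite det_mulmx det_perm odd_permV.
move/(congr1 Num.sg); rewrite sgrM /vandermonde_prod.
have sgr_prod (f : 'I_N -> 'I_N -> int) :
    Num.sg (\prod_(i < N) \prod_(j < N | (i < j)%N) f i j) =
    \prod_(i < N) \prod_(j < N | (i < j)%N) Num.sg (f i j).
  rewrite (big_morph Num.sg (@sgrM _) (sgr1 _)); apply: eq_bigr => i _.
  exact: (big_morph Num.sg (@sgrM _) (sgr1 _)).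
rewrite !sgr_prod [X in _ = _ * X]big1 => [|i _]; last first.
  by rewrite big1 // => j ij; rewrite gtr0_sg // subr_gt0 ltz_nat.
rewrite mulr1 sgrX sgrN sgr1 => <-.
apply: eq_bigr => i _; apply: eq_bigr => j ij; rewrite /= /a.
have : s i != s j by rewrite (inj_eq perm_inj) -val_eqE neq_ltn ij.
rewrite -val_eqE neq_ltn => /orP[] h.
  by rewrite h gtr0_sg // subr_gt0 ltz_nat.
by rewrite ltnNge ltnW //= ltr0_sg // subr_lt0 ltz_nat.
Qed.

(** * Determinants with laminar supports *)

Lemma det_sub_row (R : comNzRingType) n (A : 'M[R]_n) (i0 : 'I_n) (c : 'I_n -> R) :
  c i0 = 0 -> \det (\matrix_(i, j) (A i j - c i * A i0 j)) = \det A.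
Proof.
move=> c0; pose C : 'M[R]_n := \matrix_(i, j) (c i *+ (j == i0)).
have -> : \matrix_(i, j) (A i j - c i * A i0 j) = (1%:M - C) *m A.
  rewrite mulmxBl mul1mx; apply/matrixP => i j; rewrite !mxE; congr (_ - _).
  rewrite (bigD1 i0) //= !mxE eqxx big1 ?addr0 // => l /negPf li.
  by rewrite mxE li mul0r.
rewrite det_mulmx; suff -> : \det (1%:M - C) = 1 by rewrite mul1r.
rewrite (expand_det_row _ i0) (bigD1 i0) //= big1 ?addr0 => [|j /negPf ji].
  rewrite !mxE eqxx c0 mul0rn subr0 mul1r /cofactor addnn -signr_odd odd_double.
  rewrite mul1r; have -> : row' i0 (col' i0 (1%:M - C)) = 1%:M.
    apply/matrixP => i j; rewrite !mxE (inj_eq lift_inj).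
    by rewrite [lift i0 j == i0]eq_sym (negPf (neq_lift _ _)) mulr0n subr0.
  exact: det1.
by rewrite !mxE eq_sym ji mulr0n subr0 mul0r.
Qed.

Definition laminar m n (S : 'I_m -> {set 'I_n}) := forall i i',
  [|| S i \subset S i', S i' \subset S i | [disjoint S i & S i']].

(** By induction on the size. Among the rows with a 1 in the first column, let
[i0] be one of smallest support: by laminarity it is contained in the others,
and subtracting it from them removes its support from theirs. The supports stay
laminar, the first column has a single nonzero entry, and expanding along it
gives a smaller matrix of the same kind. *)
Lemma det_laminar n (S : 'I_n -> {set 'I_n}) : laminar S ->
  (`|\det (\matrix_(i, j) (j \in S i)%:R : 'M[int]_n)| <= 1)%N.
Proof.
elim: n S => [|n IHn] S lamS; first by rewrite det_mx00.
set A := (X in \det X).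
have [/existsP[i1 hi1]|none] := boolP [exists i, ord0 \in S i]; last first.
  rewrite (expand_det_col _ ord0) big1 // => i _; rewrite mxE.
  by move/existsPn: none => /(_ i)/negPf ->; rewrite mul0r.
case: (@arg_minnP _ i1 (fun i => ord0 \in S i) (fun i => #|S i|) hi1) => i0 hi0 min0.
pose c i : bool := (i != i0) && (ord0 \in S i).
pose S' i := if c i then S i :\: S i0 else S i.
have sub0 i : ord0 \in S i -> S i0 \subset S i.
  move=> hi; case/or3P: (lamS i0 i) => // [ii0|dis].
    by have := subset_leqif_card ii0; case=> le /esym;
       rewrite eqn_leq le (min0 _ hi) /= => ->.
  by move/disjointFr: dis => /(_ _ hi0); rewrite hi.
have lamS' : laminar S'.
  suff key i i' : c i -> ~~ c i' ->
      [|| S' i \subset S' i', S' i' \subset S' i | [disjoint S' i & S' i']].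
    move=> i i'; have [ci|ci] := boolP (c i); have [ci'|ci'] := boolP (c i').
    - rewrite /S' ci ci'; case/or3P: (lamS i i') => [h|h|h].
      + by rewrite (setSD _ h).
      + by rewrite (setSD _ h) orbT.
      + by rewrite (disjointWl _ (disjointWr _ h)) ?subsetDl ?orbT.
    - exact: key.
    - by case/or3P: (key _ _ ci' ci) => h; rewrite ?h ?orbT // disjoint_sym h !orbT.
    - by rewrite /S' (negPf ci) (negPf ci'); apply: lamS.
  move=> ci ci'; rewrite /S' ci (negPf ci').
  have [-> | i'0] := eqVneq i' i0.
    by rewrite -setI_eq0 setDE -setIA [~: _ :&: _]setIC setICr setI0 eqxx !orbT.
  move: ci'; rewrite /c i'0 /= => n0.
  have h0 : ord0 \in S i by case/andP: ci.
  case/or3P: (lamS i i') => [h|h|h].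
  - by rewrite (subset_trans (subsetDl _ _) h).
  - case/or3P: (lamS i' i0) => [g|g|g].
    + have d : [disjoint S i :\: S i0 & S i0].
        by rewrite -setI_eq0 setDE -setIA [~: _ :&: _]setIC setICr setI0.
      by rewrite (disjointWr g d) !orbT.
    + by case/negP: n0; apply: (subsetP g).
    + by rewrite subsetD h g /= orbT.
  - by rewrite (disjointWl (subsetDl _ _) h) !orbT.
have -> : \det A = \det (\matrix_(i, j) (j \in S' i)%:R : 'M[int]_n.+1).
  rewrite -(@det_sub_row _ _ A i0 (fun i => (c i)%:R)) /c ?eqxx //.
  congr (\det _); apply/matrixP => i j; rewrite !mxE /S' -/(c i).
  have [ci|ci] := boolP (c i); last by rewrite mul0r subr0.
  rewrite in_setD mul1r; case/andP: ci => _ /sub0/subsetP/(_ j).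
  by case: (j \in S i0) => [->|_] //=; rewrite ?subrr ?subr0.
rewrite (expand_det_col _ ord0) (bigD1 i0) //= big1 ?addr0 => [|i ii0].
  rewrite mxE /S' /c eqxx /= hi0 mul1r /cofactor abszM abszX /= exp1n mul1n.
  pose S'' i := [set j | lift ord0 j \in S' (lift i0 i)].
  have -> : row' i0 (col' ord0 (\matrix_(i, j) (j \in S' i)%:R)) =
     \matrix_(i, j) (j \in S'' i)%:R :> 'M[int]_n.
    by apply/matrixP => i j; rewrite !mxE inE.
  apply: IHn => i i'; case/or3P: (lamS' (lift i0 i) (lift i0 i')) => h.
  - apply/or3P/Or31; apply/subsetP => j; rewrite !inE; exact: (subsetP h).
  - apply/or3P/Or32; apply/subsetP => j; rewrite !inE; exact: (subsetP h).
  - apply/or3P/Or33; rewrite disjoint_subset; apply/subsetP => j; rewrite !inE.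
    by move=> hj; rewrite (disjointFr h hj).
rewrite mxE /S' /c ii0 /=; case: ifP => [h|->]; last by rewrite mul0r.
by rewrite in_setD hi0 mul0r.
Qed.

Lemma det_signed_laminar n (S : 'I_n -> {set 'I_n}) (e : 'I_n -> bool) :
  laminar S ->
  (`|(\det (\matrix_(i, j) ((-1) ^+ e i * (j \in S i)%:R) : 'M[int]_n))%R| <= 1)%N.
Proof.
move=> lamS.
have -> : \matrix_(i, j) ((-1) ^+ e i * (j \in S i)%:R) = 
    diag_mx (\row_i (-1) ^+ e i) *m
      (\matrix_(i, j) (j \in S i)%:R : 'M[int]_n) :> 'M[int]_n.
  apply/matrixP => i j; rewrite !mxE (bigD1 i) //= !mxE eqxx mulr1n.
  by rewrite big1 ?addr0 // => l /negPf li; rewrite !mxE eq_sym li mulr0n mul0r.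
rewrite det_mulmx det_diag abszM (big_morph absz abszM (erefl : absz 1 = 1%N)).
rewrite big1 ?mul1n; first exact: det_laminar.
by move=> i _; rewrite mxE abszX exp1n.
Qed.

(** * Sectors and geometric series *)

Section Sectors.

Variables (N : nat) (pi : 'S_(N + N)).
Local Notation V := 'rV[int]_(N + N).
Implicit Types (phi : 'S_N) (i j : 'I_N) (mu : V).

Definition even_coord mu i := mu 0 (lshift N i).
Definition odd_coord mu j := mu 0 (rshift N j).

(** The odd index [j] precedes the even index [i]: the quotient x_i / y_j is
then large and 1 / (1 - x_i / y_j) is expanded in negative powers. *)
Definition inverted i j : bool := (pi (rshift N j) < pi (lshift N i))%N.

Lemma invertedN i j : (pi (lshift N i) < pi (rshift N j))%N = ~~ inverted i j.
Proof.
rewrite /inverted -leqNgt [RHS]leq_eqVlt; case: eqP => // h.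
by have := perm_inj (ord_inj h) => /eqP; rewrite eq_lrshift.
Qed.

(** The condition imposed on [mu] by the pair of [i] with [j] in the sector: the
coefficient of [alpha i j] can be read off the even coordinate [i]. *)
Definition cell i j mu : bool :=
  (odd_coord mu j == - even_coord mu i) && (inverted i j == (even_coord mu i < 0)).

Lemma even_coord_alpha i i' j :
  even_coord (alpha (lshift N i) (rshift N j)) i' = (i' == i)%:R.
Proof. by rewrite /even_coord /alpha !mxE !eqxx eq_lshift eq_lrshift subr0. Qed.

Lemma odd_coord_alpha i j j' :
  odd_coord (alpha (lshift N i) (rshift N j)) j' = - (j' == j)%:R.
Proof. by rewrite /odd_coord /alpha !mxE !eqxx eq_rshift eq_rlshift sub0r. Qed.

Lemma even_coordB mu mu' i :
  even_coord (mu - mu') i = even_coord mu i - even_coord mu' i.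
Proof. by rewrite /even_coord !mxE. Qed.

Lemma odd_coordB mu mu' j :
  odd_coord (mu - mu') j = odd_coord mu j - odd_coord mu' j.
Proof. by rewrite /odd_coord !mxE. Qed.

Lemma even_coord_sum phi (a : 'I_N -> int) i :
  even_coord (\sum_i alpha (lshift N i) (match_idx phi i) *~ a i) i = a i.
Proof.
rewrite /even_coord summxE (bigD1 i) //= big1 ?addr0 => [|i' /negPf ii'].
  by rewrite -scaler_int mxE -/(even_coord _ i) even_coord_alpha eqxx mulr1 intz.
rewrite -scaler_int mxE -/(even_coord _ i) even_coord_alpha eq_sym ii'.
by rewrite mulr0.
Qed.

Lemma odd_coord_sum phi (a : 'I_N -> int) i :
  odd_coord (\sum_i alpha (lshift N i) (match_idx phi i) *~ a i) (phi i) = - a i.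
Proof.
rewrite /odd_coord summxE (bigD1 i) //= big1 ?addr0 => [|i' /negPf ii'].
  rewrite -scaler_int mxE -/(odd_coord _ (phi i)) odd_coord_alpha eqxx.
  by rewrite mulrN mulr1 intz.
rewrite -scaler_int mxE -/(odd_coord _ (phi i)) odd_coord_alpha (inj_eq perm_inj).
by rewrite eq_sym ii' oppr0 mulr0.
Qed.

Lemma coord_eq mu mu' : even_coord mu =1 even_coord mu' ->
  odd_coord mu =1 odd_coord mu' -> mu = mu'.
Proof.
move=> h1 h2; apply/rowP => l; case: (split_ordP l) => i ->.
  exact: h1.
exact: h2.
Qed.

Lemma sectorP phi mu : sector phi pi mu <-> forall i, cell i (phi i) mu.
Proof.
split=> [[a [a_ge0 a_lt0 ->]] i|h].
  rewrite /cell odd_coord_sum even_coord_sum eqxx /=.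
  have := a_ge0 i; have := a_lt0 i.
  rewrite /match_idx invertedN -/(inverted i (phi i)).
  by case: inverted => /= [/(_ isT) -> //|_ /(_ isT)]; rewrite ltNge => ->.
exists (even_coord mu); split=> [i|i|].
- rewrite /match_idx invertedN; case/andP: (h i) => _ /eqP ->.
  by rewrite -leNgt.
- rewrite /match_idx -/(inverted i (phi i)); case/andP: (h i) => _ /eqP -> //.
apply: coord_eq => [i|j]; first by rewrite even_coord_sum.
have -> : j = phi ((phi^-1)%g j) by rewrite permKV.
by rewrite odd_coord_sum; case/andP: (h ((phi^-1)%g j)) => /eqP.
Qed.

(** The coefficients of prod_i 1 / (1 - x_i / y_(phi i)) expanded in the region
of [pi]: each inverted pair contributes
1 / (1 - z) = - sum_(b < 0) z^b, hence a sign. *)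
Definition signed_sector phi mu : int :=
  \prod_i (if cell i (phi i) mu then (-1) ^+ inverted i (phi i) else 0).

Lemma signed_sectorE phi mu : signed_sector phi mu =
  if `[< sector phi pi mu >] then \prod_i (-1) ^+ inverted i (phi i) else 0.
Proof.
rewrite /signed_sector; case: asboolP => [/sectorP h|nh].
  by apply: eq_bigr => i _; rewrite h.
have [i /negPf hi] : exists i, ~~ cell i (phi i) mu.
  apply: contrapT => hn; apply: nh; apply/sectorP => i.
  by apply: contrapT => hi; apply: hn; exists i; apply/negP.
by rewrite (bigD1 i) //= hi mul0r.
Qed.

(** This sum is a determinant. In row [i], the columns allowed have the
opposite value of the coordinate and all follow [i], or all precede it,
according to the sign of that value: two rows with the same value have nested
supports, and two rows with different values have disjoint ones. *)
Lemma signed_sector_sum_le1 mu :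
  (`|(\sum_(phi : 'S_N) (-1) ^+ phi * signed_sector phi mu)%R| <= 1)%N.
Proof.
pose S i := [set j | (odd_coord mu j == - even_coord mu i) &&
  (inverted i j == (even_coord mu i < 0))].
have lamS : laminar S.
  move=> i i'.
  have [ii'|ii'] := eqVneq (even_coord mu i) (even_coord mu i'); last first.
    apply/or3P/Or33; rewrite disjoint_subset; apply/subsetP => j; rewrite !inE.
    by case/andP=> /eqP -> _; rewrite eqr_opp (negPf ii').
  have mono_inv l l' j : (pi (lshift N l) <= pi (lshift N l'))%N ->
    inverted l j -> inverted l' j by move=> h g; apply: leq_trans h.
  wlog le : i i' ii' / (pi (lshift N i) <= pi (lshift N i'))%N.
    move=> hw; case: (leqP (pi (lshift N i)) (pi (lshift N i'))) => [|/ltnW] h.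
      exact: hw.
    have := hw i' i (esym ii') h.
    by case/or3P=> g; rewrite ?g ?orbT // disjoint_sym g !orbT.
  have [neg|pos] := boolP (even_coord mu i < 0).
    apply/or3P/Or31/subsetP => j; rewrite !inE -ii' neg !eqb_id.
    by case/andP=> -> /(mono_inv _ _ _ le).
  apply/or3P/Or32/subsetP => j; rewrite !inE -ii' (negPf pos) !eqbF_neg.
  by case/andP=> -> /=; apply: contra; apply: mono_inv.
have := det_signed_laminar (fun i => even_coord mu i < 0) lamS.
rewrite /determinant; congr (`|_| <= _)%N; apply: eq_bigr => phi _.
congr (_ * _); apply: eq_bigr => i _; rewrite mxE inE -/(cell i (phi i) mu).
case hc: (cell _ _ _); last by rewrite mulr0.
by case/andP: hc => _ /eqP ->; rewrite mulr1.
Qed.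

Definition evar i : shift_op V := mono (delta_mx 0 (lshift N i)).
Definition ovar j : shift_op V := mono (delta_mx 0 (rshift N j)).

Lemma ovar_sub_evar i j :
  ovar j - evar i = ovar j * (1 - mono (alpha (lshift N i) (rshift N j))).
Proof.
by rewrite mulrBr mulr1 -monoD /alpha subrKC.
Qed.

Lemma evar_sub_ovar i j :
  evar i - ovar j = evar i * (1 - mono (alpha (rshift N j) (lshift N i))).
Proof.
by rewrite mulrBr mulr1 -monoD /alpha subrKC.
Qed.

(** The effect of the factors 1 - x_i / y_(phi i) for [i] in [D] on the
expansion: they collapse the geometric series of the indices in [D] to
their constant terms. *)
Definition partial_sector phi (D : {set 'I_N}) mu : int :=
  \prod_i (if i \in D then ((odd_coord mu (phi i) == - even_coord mu i) &&
                           (even_coord mu i == 0))%:R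
           else if cell i (phi i) mu then (-1) ^+ inverted i (phi i) else 0).

Lemma partial_sector_step phi (D : {set 'I_N}) i : i \notin D ->
  (1 - mono (alpha (lshift N i) (match_idx phi i))) (partial_sector phi D) =
  partial_sector phi (i |: D).
Proof.
move=> iD; apply/funext => mu; rewrite sopBE sop1E.
set al := alpha _ _; rewrite -[LHS]/(_ - partial_sector phi D (mu - al)).
have evB i' : even_coord (mu - al) i' = even_coord mu i' - (i' == i)%:R.
  by rewrite even_coordB even_coord_alpha.
have odB i' : odd_coord (mu - al) (phi i') = odd_coord mu (phi i') + (i' == i)%:R.
  by rewrite odd_coordB odd_coord_alpha (inj_eq (@perm_inj _ phi)) opprK.
rewrite /partial_sector (bigD1 i) //= [X in _ - X](bigD1 i) //=.
rewrite [RHS](bigD1 i) //= setU11 (negPf iD).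
set P := \prod_(i' < N | i' != i) _.
rewrite [X in _ - _ * X](_ : _ = P); last first.
  by apply: eq_bigr => i' /negPf ii'; rewrite /cell evB odB ii' subr0 addr0.
rewrite [X in _ = _ * X](_ : _ = P); last first.
  by apply: eq_bigr => i' /negPf ii'; rewrite in_setU1 ii'.
rewrite -mulrBl; congr (_ * _); rewrite /cell evB odB eqxx opprB.
rewrite [1 - _]addrC (can_eq (addrK 1)).
case: (_ == - _) => //=.
move: (even_coord mu i) => m.
have -> : (m - true%:R < 0) = (m <= 0) by lia.
by case: (inverted i (phi i)); case: (ltrgtP m 0).
Qed.

Lemma ovar_sub_evar_signed_sector phi :
  (\prod_i (ovar (phi i) - evar i)) (signed_sector phi) =
  (\prod_j ovar j) dirac.
Proof.
have step : (\prod_i (1 - mono (alpha (lshift N i) (match_idx phi i))))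
    (signed_sector phi) = dirac.
  have -> : signed_sector phi = partial_sector phi set0.
    by apply/funext => mu; apply: eq_bigr => i _; rewrite inE.
  have -> : dirac = partial_sector phi [set i in index_enum 'I_N] :> (V -> int).
    apply/funext => mu; rewrite /dirac /partial_sector; case: eqP => [->|nz].
      rewrite big1 // => i _; rewrite inE mem_index_enum.
      by rewrite /odd_coord /even_coord !mxE oppr0 !eqxx.
    apply/esym/eqP; apply: contraT => hp; case: nz.
    have hc i : (odd_coord mu (phi i) == - even_coord mu i) &&
                           (even_coord mu i == 0).
      apply: contraNT hp => /negPf h; apply/eqP.
      by rewrite (bigD1 i) //= inE mem_index_enum h mul0r.
    apply: coord_eq => [i|j].
      by case/andP: (hc i) => _ /eqP ->; rewrite /even_coord mxE.
    have -> : j = phi ((phi^-1)%g j) by rewrite permKV.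
    by case/andP: (hc ((phi^-1)%g j)) => /eqP -> /eqP ->;
       rewrite /odd_coord mxE oppr0.
  elim: (index_enum _) (index_enum_uniq 'I_N) => [_|i s IH /= /andP[i_s us]].
    by rewrite big_nil sop1E; congr partial_sector; apply/setP => i; rewrite !inE.
  rewrite big_cons sopME IH // partial_sector_step ?inE //.
  by congr partial_sector; apply/setP => i'; rewrite !inE.
rewrite [\prod_j ovar j](reindex_inj (@perm_inj _ phi)) /= -step -sopME.
congr (shift_op_fun _ _); rewrite -big_split; apply: eq_bigr => i _.
exact: ovar_sub_evar.
Qed.

End Sectors.

(** * Chords of a circle *)

Section Orientation.

Variable R : realType.
Implicit Types A B C D P : R * R.

(** Twice the signed area of the triangle A B C. *)
Definition orient A B C : R :=
  (B.1 - A.1) * (C.2 - A.2) - (B.2 - A.2) * (C.1 - A.1).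

Lemma orient_segment A B C D P : segment A B P -> segment C D P ->
  exists u, [/\ 0 <= u, u <= 1, (1 - u) * orient A B C + u * orient A B D = 0 &
    P = ((1 - u) * C.1 + u * D.1, (1 - u) * C.2 + u * D.2)].
Proof.
case=> t _ Pt [u /andP[u0 u1] Pu]; exists u; split=> //.
have : ((1 - t) * A.1 + t * B.1, (1 - t) * A.2 + t * B.2) =
       ((1 - u) * C.1 + u * D.1, (1 - u) * C.2 + u * D.2) by rewrite -Pt.
case=> e1 e2; rewrite /orient.
transitivity ((B.1 - A.1) * (((1 - u) * C.2 + u * D.2) - A.2) -
              (B.2 - A.2) * (((1 - u) * C.1 + u * D.1) - A.1)); first by ring.
by rewrite -e1 -e2; ring.
Qed.

Lemma segment_meet_lt0 A B C D P : segment A B P -> segment C D P ->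
  orient A B C != 0 -> orient A B D != 0 -> orient A B C * orient A B D < 0.
Proof.
move=> h1 h2 nC nD; have [u [u0 u1 + _]] := orient_segment h1 h2.
move: nC nD; move: (orient A B C) (orient A B D) => c d nC nD e.
have : c * d != 0 by rewrite mulf_neq0.
have cc : 0 < c * c by rewrite lt0r mulf_neq0 //= -expr2 sqr_ge0.
rewrite neq_lt => /orP[//|cd]; exfalso.
have : u * (c * d) + (1 - u) * (c * c) = 0.
  by transitivity (c * ((1 - u) * c + u * d)); [ring | rewrite e mulr0].
by nra.
Qed.

Lemma segment_meet_uniq A B C D P Q : segment A B P -> segment C D P ->
  segment A B Q -> segment C D Q -> orient A B C != orient A B D -> P = Q.
Proof.
move=> h1 h2 g1 g2 ne.
have [u [_ _ eu ->]] := orient_segment h1 h2.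
have [v [_ _ ev ->]] := orient_segment g1 g2.
suff -> : u = v by [].
apply: (mulfI (_ : orient A B C - orient A B D != 0)); first by rewrite subr_eq0.
by move: eu ev; move: (orient A B C) (orient A B D) => c d; lra.
Qed.

(** The point is found by linear interpolation of the orientation along each
segment. *)
Lemma segment_meet_exists A B C D :
  orient A B C * orient A B D < 0 -> orient C D A * orient C D B < 0 ->
  exists P, segment A B P /\ segment C D P.
Proof.
have ratio (c d : R) : c * d < 0 -> c - d != 0 /\ 0 <= c / (c - d) <= 1.
  move=> cd; have cd0 : c - d != 0.
    by apply/eqP => h; have e : c = d by [lra]; move: cd; rewrite e -expr2 ltNge sqr_ge0.
  split=> //; have [c0|c0] := ltP 0 c.
    have d0 : d < 0 by nra.
    have h : 0 < c - d by lra.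
    by rewrite ler_pdivrMr // ler_pdivlMr // mul0r mul1r; lra.
  have d0 : 0 < d by nra.
  have h : 0 < d - c by lra.
  have -> : c / (c - d) = (- c) / (d - c) by field; rewrite cd0 -opprB oppr_eq0 cd0.
  by rewrite ler_pdivrMr // ler_pdivlMr // mul0r mul1r; lra.
move=> /ratio[n1 r1] /ratio[n2 r2].
exists ((1 - orient A B C / (orient A B C - orient A B D)) * C.1 +
          orient A B C / (orient A B C - orient A B D) * D.1,
        (1 - orient A B C / (orient A B C - orient A B D)) * C.2 +
          orient A B C / (orient A B C - orient A B D) * D.2).
split; last by exists (orient A B C / (orient A B C - orient A B D)).
exists (orient C D A / (orient C D A - orient C D B)) => //.
move: n1 n2; rewrite /orient => n1 n2.
by congr (_, _); field; rewrite n1 n2.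
Qed.

(** All sines and cosines are written in terms of the half angles. Both sides
are then equal after the left one is made homogeneous by factors
cos^2 + sin^2. *)
Lemma orient_circle (x y z : R) :
  orient (cos x, sin x) (cos y, sin y) (cos z, sin z) =
  4 * sin ((y - x) / 2) * sin ((z - y) / 2) * sin ((z - x) / 2).
Proof.
have half (t : R) : t = t / 2 + t / 2 by field.
rewrite !mulrBl !sinB /orient /=.
rewrite [in LHS](half x) [in LHS](half y) [in LHS](half z) !cosD !sinD.
have := cos2Dsin2 (x / 2); have := cos2Dsin2 (y / 2); have := cos2Dsin2 (z / 2).
move: (cos (x / 2)) (sin (x / 2)) (cos (y / 2)) (sin (y / 2)) (cos (z / 2))
  (sin (z / 2)) => cx sx cy sy cz sz hz hy hx.
transitivity (
  ((cx * cx - sx * sx) * (sy * cy + cy * sy) * (cz ^+ 2 + sz ^+ 2) -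
  (sx * cx + cx * sx) * (cy * cy - sy * sy) * (cz ^+ 2 + sz ^+ 2) +
  (cy * cy - sy * sy) * (sz * cz + cz * sz) * (cx ^+ 2 + sx ^+ 2) -
  (sy * cy + cy * sy) * (cz * cz - sz * sz) * (cx ^+ 2 + sx ^+ 2) +
  (cz * cz - sz * sz) * (sx * cx + cx * sx) * (cy ^+ 2 + sy ^+ 2) -
  (sz * cz + cz * sz) * (cx * cx - sx * sx) * (cy ^+ 2 + sy ^+ 2))).
  by rewrite hx hy hz; ring.
by ring.
Qed.

Lemma sg_sin_half (t : R) : `|t| < trigo.pi *+ 2 -> Num.sg (sin (t / 2)) = Num.sg t.
Proof.
have pos (s : R) : 0 < s -> s < trigo.pi *+ 2 -> 0 < sin (s / 2).
  move=> s0 s2; apply: sin_gt0_pi; rewrite divr_gt0 //=.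
  by rewrite ltr_pdivrMr // mulr_natr.
rewrite ltr_norml => /andP[h1 h2]; case: (ltrgtP t 0) => ht.
- rewrite (ltr0_sg ht) ltr0_sg // -oppr_gt0 -sinN -mulNr pos //; lra.
- by rewrite (gtr0_sg ht) gtr0_sg // pos.
- by rewrite ht mul0r sin0.
Qed.

End Orientation.

(** * The parity of the number of crossings *)

Section Crossings.

Variables (R : realType) (N : nat) (pi : 'S_(N + N)) (phi : 'S_N).
Variable a : 'I_(N + N) -> R * R.
Hypotheses (a_clockwise : clockwise a) (a_general : general_position a).

Implicit Types p q : 'I_(N + N).

(** The chords p q and p' q' separate each other: this exclusive or is the sign
of the product of the orientations of p', q' with respect to p q. *)
Definition interleaved p q p' q' : bool :=
  (p < p')%N (+) (q < p')%N (+) (p < q')%N (+) (q < q')%N.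

Lemma sg_orient p q r : p != q -> q != r -> p != r ->
  Num.sg (orient (a p) (a q) (a r)) =
  (-1) ^+ ((p < q)%N (+) (q < r)%N (+) (p < r)%N).
Proof.
case: a_clockwise => theta [decr_th lt_2pi aE] pq qr pr.
have sgE i j : i != j -> Num.sg (sin ((theta j - theta i) / 2)) = (-1) ^+ (i < j)%N.
  move=> ij; rewrite sg_sin_half; last first.
    by rewrite ltr_norml lt_2pi andbT ltrNl opprB lt_2pi.
  move: ij; rewrite -val_eqE neq_ltn => /orP[] ij.
    by rewrite ij ltr0_sg // subr_lt0 decr_th.
  by rewrite ltnNge ltnW //= gtr0_sg // subr_gt0 decr_th.
rewrite !aE orient_circle !sgrM !sgE // (gtr0_sg (ltr0n _ 4)) mul1r.
by rewrite !signr_addb.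
Qed.

Lemma orient_neq0 p q r : p != q -> q != r -> p != r ->
  orient (a p) (a q) (a r) != 0.
Proof. by move=> pq qr pr; rewrite -sgr_eq0 sg_orient // signr_eq0. Qed.

Lemma orient_lt0 p q p' q' : uniq [:: p; q; p'; q'] ->
  (orient (a p) (a q) (a p') * orient (a p) (a q) (a q') < 0) =
  interleaved p q p' q'.
Proof.
rewrite /= !inE !negb_or => /and4P[/and3P[pq pp' pq'] /andP[qp' qq'] p'q' _].
rewrite -sgr_lt0 sgrM !sg_orient // -signr_addb -/(interleaved _ _ _ _).
have -> : (p < q)%N (+) (q < p')%N (+) (p < p')%N (+)
    ((p < q)%N (+) (q < q')%N (+) (p < q')%N) = interleaved p q p' q'.
  by rewrite /interleaved; do 5!case: (_ < _)%N.
by case: interleaved; rewrite /= ?expr0 ?expr1 ?ltrN10 ?ltr10.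
Qed.

Lemma interleavedC p q p' q' : uniq [:: p; q; p'; q'] ->
  interleaved p' q' p q = interleaved p q p' q'.
Proof.
rewrite /= !inE !negb_or => /and4P[/and3P[pq pp' pq'] /andP[qp' qq'] p'q' _].
have neg (i j : 'I_(N + N)) : i != j -> (j < i)%N = ~~ (i < j)%N.
  by move=> ij; case: ltngtP => // /ord_inj h; rewrite h eqxx in ij.
rewrite /interleaved (neg p p') // (neg p q') // (neg q p') // (neg q q') //.
by do 4!case: (_ < _)%N.
Qed.

Lemma chords_meetP p q p' q' : uniq [:: p; q; p'; q'] ->
  (exists P, segment (a p) (a q) P /\ segment (a p') (a q') P) <->
  interleaved p q p' q'.
Proof.
move=> u; have u' : uniq [:: p'; q'; p; q].
  by rewrite -[_ :: _]/([:: p'; q'] ++ [:: p; q]) uniq_catC.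
have := u; rewrite /= !inE !negb_or => /and4P[/and3P[pq pp' pq'] /andP[qp' qq'] p'q' _].
split=> [[P [h1 h2]]|h].
  rewrite -(orient_lt0 u); apply: (segment_meet_lt0 h1 h2); exact: orient_neq0.
by apply: segment_meet_exists; rewrite orient_lt0 // interleavedC.
Qed.

Lemma chords_meet_uniq p q p' q' P Q : uniq [:: p; q; p'; q'] ->
  segment (a p) (a q) P -> segment (a p') (a q') P ->
  segment (a p) (a q) Q -> segment (a p') (a q') Q -> P = Q.
Proof.
move=> u h1 h2 g1 g2; apply: (segment_meet_uniq h1 h2 g1 g2).
have := u; rewrite /= !inE !negb_or => /and4P[/and3P[pq pp' pq'] /andP[qp' qq'] p'q' _].
have h : orient (a p) (a q) (a p') * orient (a p) (a q) (a q') < 0.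
  by apply: (segment_meet_lt0 h1 h2); apply: orient_neq0.
by apply: contraTneq h => ->; rewrite -leNgt -expr2 sqr_ge0.
Qed.

Definition even_end (i : 'I_N) := pi (lshift N i).
Definition odd_end (i : 'I_N) := pi (match_idx phi i).

Definition crossing_pairs : {set 'I_N * 'I_N} :=
  [set ij : 'I_N * 'I_N | (ij.1 < ij.2)%N &&
     interleaved (even_end ij.1) (odd_end ij.1) (even_end ij.2) (odd_end ij.2)].

(** Chords of distinct indices have distinct ends; stated for a list in order to
cover two chords and three chords. *)
Lemma ends_uniq (s : seq 'I_N) : uniq s ->
  uniq (flatten [seq [:: even_end i; odd_end i] | i <- s]).
Proof.
have EE i j : (even_end i == even_end j) = (i == j).
  by rewrite (inj_eq perm_inj) eq_lshift.
have OO i j : (odd_end i == odd_end j) = (i == j).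
  by rewrite (inj_eq perm_inj) eq_rshift (inj_eq perm_inj).
have EO i j : (even_end i == odd_end j) = false.
  by rewrite (inj_eq perm_inj) eq_lrshift.
have mem i s' : ((even_end i \in flatten [seq [:: even_end i; odd_end i] | i <- s']) =
     (i \in s')) * ((odd_end i \in flatten [seq [:: even_end i; odd_end i] | i <- s']) =
     (i \in s')).
  elim: s' => [|j s' IH] //=; rewrite !inE !IH EE OO EO [odd_end i == _]eq_sym EO /=.
  by split.
elim: s => //= i s IH /andP[i_s us].
by rewrite inE EO !mem (negPf i_s) /= IH.
Qed.

Definition meeting_point (ij : 'I_N * 'I_N) : R * R :=
  xget (0, 0) [set P | chord a phi pi ij.1 P /\ chord a phi pi ij.2 P]%classic.

Lemma meeting_pointP ij : ij \in crossing_pairs ->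
  chord a phi pi ij.1 (meeting_point ij) /\ chord a phi pi ij.2 (meeting_point ij).
Proof.
rewrite inE => /andP[lt_ij il]; rewrite /meeting_point.
have u : uniq [:: ij.1; ij.2] by rewrite /= inE -val_eqE neq_ltn lt_ij.
have [P hP] := (chords_meetP (ends_uniq u)).2 il.
by case: xgetP => [Q -> //|/(_ P)].
Qed.

(** If two pairs of chords had the same crossing point, a chord of the second
pair outside the first would pass through it, giving three concurrent chords. *)
Lemma crossing_numberE : crossing_number a phi pi = #|crossing_pairs|.
Proof.
rewrite /crossing_number.
have -> : crossings a phi pi = [set` [seq meeting_point ij | ij <- enum crossing_pairs]]%classic.
  apply/seteqP; split=> P /=.
    move=> [i [j [ij hi hj]]].
    wlog lt_ij : i j ij hi hj / (i < j)%N.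
      move=> hw; case: (ltngtP i j) => h; [exact: hw h| |].
        by apply: (hw j i) => //; rewrite eq_sym.
      by rewrite (ord_inj h) eqxx in ij.
    have u : uniq [:: i; j] by rewrite /= inE ij.
    have hin : (i, j) \in crossing_pairs.
      rewrite inE /= lt_ij /=; apply/(chords_meetP (ends_uniq u)).
      by exists P.
    apply/mapP; exists (i, j); first by rewrite mem_enum.
    have [h1 h2] := meeting_pointP hin.
    exact: (chords_meet_uniq (ends_uniq u)).
  case/mapP=> [[i j]]; rewrite mem_enum => hin ->.
  have [h1 h2] := meeting_pointP hin; exists i, j; split=> //.
  by move: hin; rewrite inE /= -val_eqE neq_ltn => /andP[->].
have -> : fset_set [set` [seq meeting_point ij | ij <- enum crossing_pairs]]%classic =
    [fset P in [seq meeting_point ij | ij <- enum crossing_pairs]]%fset.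
  apply/fsetP => P; rewrite (in_fset_set (finite_seq _)); apply/idP/idP.
    by move=> /set_mem h; apply/imfsetP; exists P.
  by case/imfsetP=> Q hQ ->; apply/mem_set.
rewrite card_imfset //= undup_id ?size_map ?cardE //.
rewrite map_inj_in_uniq ?enum_uniq // => -[i j] [i' j'].
rewrite !mem_enum => h h' e; apply/eqP; apply: contraT => ne.
have [h1 h2] := meeting_pointP h; have [h1' h2'] := meeting_pointP h'.
rewrite -e /= in h1' h2'; rewrite /= in h1 h2.
move: h h'; rewrite !inE /= => /andP[lt_ij _] /andP[lt_ij' _].
have concur l : l != i -> l != j -> chord a phi pi l (meeting_point (i, j)) -> False.
  move=> li lj hl; have u : uniq [:: i; j; l].
    by rewrite /= !inE negb_or -val_eqE neq_ltn lt_ij (eq_sym i) li (eq_sym j) lj.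
  by apply: (a_general (ends_uniq u) (P := meeting_point (i, j))).
have [ii'|ni] := eqVneq i' i.
  have [jj'|nj] := eqVneq j' j; first by rewrite ii' jj' eqxx in ne.
  by case: (concur j') => //; rewrite -val_eqE neq_ltn -ii' lt_ij' orbT.
have [ij'|nj] := eqVneq i' j; last by case: (concur i').
by case: (concur j') => //; rewrite -val_eqE neq_ltn ?(ltn_trans lt_ij) ?orbT //
  -ij' // lt_ij' orbT.
Qed.

Hypothesis pi_shuffle : is_shuffle pi.

(** Shuffles keep the even ends in order, and the odd ends in the order of
their indices, so two of the four comparisons defining [interleaved] are a
constant and an inversion of [phi]. *)
Lemma interleaved_sign (i j : 'I_N) : (i < j)%N ->
  (-1) ^+ interleaved (even_end i) (odd_end i) (even_end j) (odd_end j) =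
  -1 * ((-1) ^+ inverted pi i (phi j) * (-1) ^+ inverted pi j (phi i)) *
    (if (phi i < phi j)%N then 1 else -1) :> int.
Proof.
move=> lt_ij; rewrite /interleaved.
have -> : (even_end i < even_end j)%N by apply: pi_shuffle.1.
have -> : (odd_end i < odd_end j)%N = (phi i < phi j)%N.
  case: (ltngtP (phi i) (phi j)) => h.
  - by apply: pi_shuffle.2.
  - by apply/negbTE; rewrite -leqNgt ltnW //; apply: pi_shuffle.2.
  - have := lt_ij; rewrite (perm_inj (ord_inj h)); by rewrite ltnn.
rewrite invertedN -/(inverted pi j (phi i)).
by case: inverted; case: inverted; case: ltnP.
Qed.

(** The product of [interleaved_sign] over all pairs. The pairs (i, phi i),
which it misses, occur once in the double product over [i] and [j] and once in
the last product. *)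
Lemma crossing_sign :
  (-1) ^+ crossing_number a phi pi =
  pair_sign int N * (\prod_i \prod_j (-1) ^+ inverted pi i j) * (-1) ^+ phi *
  \prod_i (-1) ^+ inverted pi i (phi i) :> int.
Proof.
rewrite crossing_numberE -prodr_const big_mkcond /=.
transitivity (\prod_(i < N) \prod_(j < N | (i < j)%N)
    (-1) ^+ interleaved (even_end i) (odd_end i) (even_end j) (odd_end j) : int).
  rewrite pair_big_dep [RHS]big_mkcond /=; apply: eq_bigr => -[i j] _ /=.
  by rewrite inE /=; case: ltnP => //=; case: interleaved.
rewrite sign_inversions /pair_sign.
have -> : \prod_i \prod_j (-1) ^+ inverted pi i j =
    \prod_i (-1) ^+ inverted pi i (phi i) *
    \prod_(i < N) \prod_(j < N | (i < j)%N)
      ((-1) ^+ inverted pi i (phi j) * (-1) ^+ inverted pi j (phi i)) :> int.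
  transitivity (\prod_i ((-1) ^+ inverted pi i (phi i) *
      (\prod_(j < N | (i < j)%N) (-1) ^+ inverted pi i (phi j) *
       \prod_(j < N | (j < i)%N) (-1) ^+ inverted pi i (phi j))) : int).
    apply: eq_bigr => i _; rewrite (reindex_inj (@perm_inj _ phi)) /=.
    rewrite (bigD1 i) //=; congr (_ * _).
    rewrite (bigID (fun j : 'I_N => (i < j)%N)) /=.
    by congr (_ * _); apply: eq_bigl => j; rewrite -val_eqE /=; case: ltngtP.
  rewrite big_split /=; congr (_ * _); rewrite big_split /=.
  rewrite [X in _ * X](exchange_big_dep xpredT) //= -big_split /=.
  by apply: eq_bigr => i _; rewrite -big_split.
set E := \prod_i (-1) ^+ inverted pi i (phi i).
have EE : E * E = 1 by rewrite -big_split big1 //= => i _; rewrite -expr2 sqrr_sign.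
set Q := \prod_(i < N) \prod_(j < N | _) (_ * _).
set S := \prod_(i < N) \prod_(j < N | _) (if _ then _ else _).
set T := \prod_(i < N) \prod_(j < N | _) (-1).
transitivity (T * Q * S); last first.
  by transitivity (T * Q * S * (E * E)); [rewrite EE mulr1 | ring].
rewrite /T /Q /S -!big_split /=; apply: eq_bigr => i _; rewrite -!big_split /=.
by apply: eq_bigr => j lt_ij; rewrite interleaved_sign.
Qed.

End Crossings.

(** * Products over roots *)

Section Level.

Variables (N : nat) (pi : 'S_(N + N)).
Local Notation V := 'rV[int]_(N + N).

(** The linear form for which the roots of [pi] have positive weights. *)
Definition level (v : V) : int := \sum_i - (pi i)%:Z * v 0 i.

Lemma level_is_zmod_morphism : zmod_morphism level.
Proof.
move=> v w; rewrite /level -sumrB; apply: eq_bigr => i _.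
by rewrite !mxE mulrBr.
Qed.

HB.instance Definition _ :=
  GRing.isZmodMorphism.Build V int level level_is_zmod_morphism.

Lemma level_delta l : level (delta_mx 0 l) = - (pi l)%:Z.
Proof.
rewrite /level (bigD1 l) //= mxE !eqxx mulr1 big1 ?addr0 // => i /negPf il.
by rewrite mxE il andbF mulr0.
Qed.

Lemma level_alpha p q : level (alpha p q) = (pi q)%:Z - (pi p)%:Z.
Proof. by rewrite /alpha raddfB /= !level_delta opprK addrC. Qed.

Lemma absz_level v : `|level v|%N = deg_bound pi v.
Proof.
rewrite /deg_bound -abszN /level -sumrN; congr absz.
by apply: eq_bigr => i _; rewrite mulNr opprK.
Qed.

End Level.

Section ProductOverRoots.

Variables (A : comNzRingType) (N : nat) (pi : 'S_(N + N)).

Lemma prod_root (P : 'I_(N + N) -> 'I_(N + N) -> bool)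
    (F : 'I_(N + N) -> 'I_(N + N) -> A) :
  \prod_(r : Defs.root pi | P (val r).1 (val r).2) F (val r).1 (val r).2 =
  \prod_p \prod_(q | (pi p < pi q)%N && P p q) F p q.
Proof.
rewrite pair_big_dep /=.
rewrite (reindex_omap (val : Defs.root pi -> _) insub) /=; last first.
  by move=> pq /andP[h _]; rewrite insubT.
by apply: eq_bigl => r; rewrite valK eqxx andbT (valP r).
Qed.

Hypothesis pi_shuffle : is_shuffle pi.

Lemma lt_lshift i i' : (pi (lshift N i) < pi (lshift N i'))%N = (i < i')%N.
Proof.
case: (ltngtP i i') => [h|h|/ord_inj ->]; last by rewrite ltnn.
  exact: pi_shuffle.1.
by apply/negbTE; rewrite -leqNgt ltnW //; apply: pi_shuffle.1.
Qed.

Lemma lt_rshift i i' : (pi (rshift N i) < pi (rshift N i'))%N = (i < i')%N.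
Proof.
case: (ltngtP i i') => [h|h|/ord_inj ->]; last by rewrite ltnn.
  exact: pi_shuffle.2.
by apply/negbTE; rewrite -leqNgt ltnW //; apply: pi_shuffle.2.
Qed.

Lemma odd_line_l i : odd_line (lshift N i) = false.
Proof. by rewrite /odd_line /= leqNgt ltn_ord. Qed.

Lemma odd_line_r i : odd_line (rshift N i) = true.
Proof. by rewrite /odd_line /= leq_addr. Qed.

Lemma prod_odd_roots (F : 'I_(N + N) -> 'I_(N + N) -> A) :
  \prod_(r : Defs.root pi | root_par r) F (val r).1 (val r).2 =
  \prod_(i < N) \prod_(j < N) (if inverted pi i j
     then F (rshift N j) (lshift N i) else F (lshift N i) (rshift N j)).
Proof.
rewrite (prod_root (fun p q => odd_line p (+) odd_line q)) big_split_ord /=.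
transitivity (\prod_(i < N) \prod_(j < N | ~~ inverted pi i j)
    F (lshift N i) (rshift N j) *
  \prod_(i < N) \prod_(j < N | inverted pi i j) F (rshift N j) (lshift N i)).
  congr (_ * _).
    apply: eq_bigr => i _; rewrite big_mkcond big_split_ord /= big1 ?mul1r.
      by rewrite [RHS]big_mkcond; apply: eq_bigr => j _;
        rewrite invertedN odd_line_l odd_line_r andbT.
    by move=> j _; rewrite !odd_line_l andbF.
  rewrite [RHS](exchange_big_dep xpredT) //=; apply: eq_bigr => j _.
  rewrite big_mkcond big_split_ord /= [X in _ * X]big1 ?mulr1.
    by rewrite [RHS]big_mkcond; apply: eq_bigr => i _;
        rewrite odd_line_l odd_line_r andbT.
  by move=> i _; rewrite !odd_line_r andbF.
rewrite -big_split /=; apply: eq_bigr => i _.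
rewrite [X in X * _]big_mkcond [X in _ * X]big_mkcond -big_split /=.
by apply: eq_bigr => j _; case: inverted; rewrite ?mul1r ?mulr1.
Qed.

Lemma prod_even_roots (F : 'I_(N + N) -> 'I_(N + N) -> A) :
  \prod_(r : Defs.root pi | ~~ root_par r) F (val r).1 (val r).2 =
  \prod_(i < N) \prod_(j < N | (i < j)%N)
    (F (lshift N i) (lshift N j) * F (rshift N i) (rshift N j)).
Proof.
rewrite (prod_root (fun p q => ~~ (odd_line p (+) odd_line q))) big_split_ord /=.
rewrite -big_split /=; apply: eq_bigr => i _; rewrite [RHS]big_split /=.
congr (_ * _).
  rewrite big_mkcond big_split_ord /= [X in _ * X]big1 ?mulr1.
    by rewrite [RHS]big_mkcond; apply: eq_bigr => j _;
        rewrite lt_lshift !odd_line_l andbT.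
  by move=> j _; rewrite odd_line_l odd_line_r andbF.
rewrite big_mkcond big_split_ord /= big1 ?mul1r.
  by rewrite [RHS]big_mkcond; apply: eq_bigr => j _;
        rewrite lt_rshift !odd_line_r andbT.
by move=> j _; rewrite odd_line_l odd_line_r andbF.
Qed.

End ProductOverRoots.

(** * Comparison of the two series *)

Section Comparison.

Variables (k : fieldType) (N : nat) (pi : 'S_(N + N)).
Hypotheses (two_neq0 : 2 != 0 :> k) (pi_shuffle : is_shuffle pi).

Local Notation V := 'rV[int]_(N + N).
Local Notation x := (@evar N).
Local Notation y := (@ovar N).
Local Notation lev := (level pi).

Definition num_inverted : nat := \sum_(i < N) \sum_(j < N) inverted pi i j.
Definition num_pairs : nat := \sum_(i < N) \sum_(j < N | (i < j)%N) 1.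

Lemma pair_signE (A : comNzRingType) : pair_sign A N = (-1) ^+ num_pairs.
Proof.
rewrite /num_pairs -prodrXr; apply: eq_bigr => i _.
by rewrite -prodrXr; apply: eq_bigr => j _; rewrite expr1.
Qed.

Lemma inverted_signE (A : comNzRingType) :
  \prod_(i < N) \prod_(j < N) (-1) ^+ inverted pi i j = (-1) ^+ num_inverted :> A.
Proof.
by rewrite /num_inverted -prodrXr; apply: eq_bigr => i _; rewrite -prodrXr.
Qed.

Definition all_differences : shift_op V := \prod_(i < N) \prod_(j < N) (y j - x i).

(** The monomials by which the factors 1 - s_p / s_q, for p and q of different
([odd_monomial]) and of the same ([even_monomial]) parity, are multiplied in
order to become differences of variables. *)
Definition odd_monomial : V := \sum_(i < N) \sum_(j < N)
  (if inverted pi i j then delta_mx 0 (lshift N i) else delta_mx 0 (rshift N j)).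

Definition even_monomial : V := \sum_(i < N) \sum_(j < N | (i < j)%N)
  (delta_mx 0 (lshift N j) + delta_mx 0 (rshift N j)).

Lemma odd_roots_cleared :
  mono odd_monomial * \prod_(r | root_par r) (1 - mono (@root_wt N pi r)) =
  (-1) ^+ num_inverted * all_differences.
Proof.
rewrite (prod_odd_roots pi (fun p q => 1 - mono (alpha p q))).
rewrite mono_sum -inverted_signE -!big_split /=; apply: eq_bigr => i _.
rewrite mono_sum -!big_split /=; apply: eq_bigr => j _.
case: inverted; first by rewrite expr1 mulN1r opprB evar_sub_ovar.
by rewrite expr0 mul1r ovar_sub_evar.
Qed.

Lemma even_roots_cleared :
  mono even_monomial * \prod_(r | ~~ root_par r) (1 - mono (@root_wt N pi r)) =
  vandermonde_prod x * vandermonde_prod y.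
Proof.
rewrite (prod_even_roots pi_shuffle (fun p q => 1 - mono (alpha p q))).
rewrite mono_sum -!big_split /=; apply: eq_bigr => i _.
rewrite mono_sum -!big_split /=; apply: eq_bigr => j _.
by rewrite monoD mulrACA !mulrBr !mulr1 -!monoD /alpha !subrKC.
Qed.

(** This is where the shift by [delta pi1 - delta pi] comes from. Adding
[delta pi] to [odd_monomial] turns every x_i in it into y_j, and [delta pi1]
does the same for the even variables of [even_monomial]. *)
Lemma monomial_balance :
  even_monomial + (delta (pi1 N) - delta pi) +
    \sum_(j < N) delta_mx 0 (rshift N j) = odd_monomial.
Proof.
apply/eqP; rewrite addrAC addrA subr_eq; apply/eqP.
have -> : odd_monomial + delta pi =
    \sum_(i < N) \sum_(j < N) (delta_mx 0 (rshift N j) : V).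
  rewrite -big_split; apply: eq_bigr => i _ /=.
  rewrite [X in _ + X]big_mkcond -big_split; apply: eq_bigr => j _ /=.
  rewrite -/(inverted pi i j) /alpha; case: inverted; last by rewrite addr0.
  by rewrite subrKC.
have -> : delta (pi1 N) = \sum_(i < N) \sum_(j < N | (j < i)%N)
    alpha (rshift N j) (lshift N i).
  apply: eq_bigr => i _; apply: eq_bigl => j.
  by rewrite !permE pi1_fun_lshift pi1_fun_rshift ltn_Sdouble.
pose L : V := \sum_(i < N) \sum_(j < N | (i < j)%N) delta_mx 0 (lshift N j).
pose U : V := \sum_(i < N) \sum_(j < N | (i < j)%N) delta_mx 0 (rshift N j).
pose W : V := \sum_(i < N) \sum_(j < N | (j < i)%N) delta_mx 0 (rshift N j).
have -> : even_monomial = L + U.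
  by rewrite -big_split; apply: eq_bigr => i _; rewrite big_split.
have -> : \sum_(i < N) \sum_(j < N | (j < i)%N) alpha (rshift N j) (lshift N i) = W - L.
  rewrite [L](exchange_big_dep xpredT) //= -sumrB; apply: eq_bigr => i _.
  by rewrite -sumrB.
transitivity (U + W + \sum_(j < N) delta_mx 0 (rshift N j)).
  by rewrite addrAC; congr (_ + _); rewrite [LHS]addrC addrA subrK addrC.
rewrite -!big_split /=; apply: eq_bigr => i _.
rewrite [RHS](bigD1 i) //= addrC; congr (_ + _).
rewrite [RHS](bigID (fun j : 'I_N => (i < j)%N)) /=.
by congr (_ + _); apply: eq_bigl => j; rewrite -val_eqE /=; case: ltngtP.
Qed.

(** The sum over bijections in the theorem, up to a sign depending on [pi] alone
and before the shift of the weight. *)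
Definition sector_sum (mu : V) : int :=
  \sum_(phi : 'S_N) (-1) ^+ phi * signed_sector pi phi mu.

(** For each [phi], the factors y_(phi i) - x_i collapse the geometric series,
and the remaining factors are the summand of [phi] in [cauchy_det]. *)
Lemma all_differences_sector_sum :
  (vandermonde_prod y * all_differences) sector_sum =
  (pair_sign _ N * vandermonde_prod x * vandermonde_prod y * vandermonde_prod y *
    \prod_j y j) dirac.
Proof.
rewrite -cauchy_det -[in RHS]mulrA sopME [RHS]sopME.
congr (shift_op_fun _ _); rewrite mulr_suml sop_sumE.
have -> : sector_sum = \sum_(phi : 'S_N) ((-1) ^+ phi : shift_op V) (signed_sector pi phi).
  apply/funext => mu; rewrite fct_sumE; apply: eq_bigr => phi _.
  by rewrite -[X in shift_op_fun X]mulr1 sop_signE.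
rewrite shift_op_sumr; apply: eq_bigr => phi _.
rewrite [RHS]sopME -(ovar_sub_evar_signed_sector pi phi) -!sopME.
congr (shift_op_fun _ _); rewrite mulrC -mulrA; congr (_ * _).
rewrite -big_split; apply: eq_bigr => i _ /=.
by rewrite [LHS](bigD1 (phi i)) //= mulrC.
Qed.

Lemma lev_root_gt0 (r : Defs.root pi) : 0 < lev (root_wt r).
Proof. by rewrite /root_wt level_alpha subr_gt0 ltz_nat (valP r). Qed.

(** Each sector lies in the half-space of nonnegative level, like the series of
Euler characteristics: both are expansions in the same region. *)
Lemma sector_sum_lev mu : sector_sum mu != 0 -> 0 <= lev mu.
Proof.
apply: contraNT; rewrite -ltNge => lt0; apply/eqP; apply: big1 => phi _.
rewrite signed_sectorE; case: asboolP => [[a [a_ge0 a_lt0 muE]]|]; last by rewrite mulr0.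
move: lt0; rewrite ltNge => /negP[]; rewrite muE raddf_sum; apply: sumr_ge0 => i _.
rewrite raddfMz /= level_alpha.
have := a_ge0 i; have := a_lt0 i.
rewrite invertedN -/(inverted pi i (phi i)).
have := invertedN pi i (phi i); rewrite /match_idx.
case hi: inverted => /= h; first move=> /(_ isT) ai _.
  move: hi; rewrite /inverted -ltz_nat; move: (_%:Z) (_%:Z) => p q.
  by rewrite mulrzz; nia.
move=> _ /(_ isT) ai; move: h; rewrite -ltz_nat; move: (_%:Z) (_%:Z) => p q.
by rewrite mulrzz; nia.
Qed.

Lemma regular_differences : regular lev (vandermonde_prod y * all_differences).
Proof.
have lev_neq p q : p != q -> lev (delta_mx 0 p) != lev (delta_mx 0 q).
  by move=> pq; rewrite !level_delta eqr_opp eqz_nat val_eqE (inj_eq perm_inj).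
apply: regularM; apply: regular_prod => i _; apply: regular_prod => j ij;
  apply: regular_mono_sub; apply: lev_neq.
  by rewrite eq_rshift -val_eqE neq_ltn ij orbT.
by rewrite eq_rlshift.
Qed.

(** Both series are half-supported, and become equal after multiplication by
the regular operator
s^even_monomial V(y) prod_(i, j) (y_j - x_i). *)
Lemma euler_char_sector_sum lam :
  euler_char k pi lam =
  (-1) ^+ (num_pairs + num_inverted) *
  sector_sum (lam - delta (pi1 N) + delta pi).
Proof.
have cE B mu : (0 < B)%N -> `|lev mu| <= B ->
    euler_char k pi mu = signed_count (@root_par N pi) (@root_wt N pi) B mu.
  by move=> _; rewrite -abszE lez_nat absz_level => h; apply: euler_charE.
have [genE c_half] := generating_function lev_root_gt0 cE.
pose s : shift_op V := (-1) ^+ (num_pairs + num_inverted).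
pose g := (s * mono (delta (pi1 N) - delta pi)) sector_sum.
have gE mu : g mu = (-1) ^+ (num_pairs + num_inverted) *
    sector_sum (mu - delta (pi1 N) + delta pi).
  by rewrite /g sop_signE /= /shift opprB addrA addrAC.
rewrite -gE; have g_half : half_supported lev g.
  exists (lev (delta (pi1 N) - delta pi)) => mu; rewrite gE.
  rewrite mulf_eq0 signr_eq0 /= => /sector_sum_lev.
  by rewrite raddfD /= raddfB /= raddfB /=; lra.
suff -> : euler_char k pi = g by [].
have reg : regular lev (mono even_monomial * (vandermonde_prod y * all_differences)).
  by apply: regularM; [exact: regular_mono|exact: regular_differences].
apply: (regular_eq reg) => //.
have sq (n : nat) : (-1) ^+ n * (-1) ^+ n = 1 :> shift_op V.
  by rewrite -expr2 sqrr_sign.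
have allE : all_differences = (-1) ^+ num_inverted * mono odd_monomial *
    \prod_(r | root_par r) (1 - mono (@root_wt N pi r)).
  by rewrite -mulrA odd_roots_cleared mulrA sq mul1r.
transitivity (((-1) ^+ num_inverted * vandermonde_prod y * mono odd_monomial *
   (vandermonde_prod x * vandermonde_prod y) : shift_op V) dirac).
  rewrite -even_roots_cleared [in LHS]allE.
  transitivity (((-1) ^+ num_inverted * vandermonde_prod y * mono odd_monomial *
     mono even_monomial : shift_op V) ((\prod_(r | root_par r) (1 - mono (@root_wt N pi r)))
       (euler_char k pi))).
    by rewrite -[RHS]sopME; congr (shift_op_fun _ _); ring.
  rewrite genE /exterior_part -[LHS]sopME; congr (shift_op_fun _ _).
rewrite /g -[RHS]sopME.
transitivity ((mono even_monomial * s * mono (delta (pi1 N) - delta pi) : shift_op V)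
   ((vandermonde_prod y * all_differences) sector_sum)); last first.
  by rewrite -[LHS]sopME; congr (shift_op_fun _ _); ring.
rewrite all_differences_sector_sum -[RHS]sopME; congr (shift_op_fun _ _).
have odd_prod : mono (\sum_(j < N) delta_mx 0 (rshift N j)) = \prod_j y j.
  exact: mono_sum.
rewrite -monomial_balance monoD (monoD even_monomial) odd_prod pair_signE /s exprD.
move: (sq num_pairs); move: ((-1) ^+ num_pairs) ((-1) ^+ num_inverted) => b c bb.
transitivity (b * b * c * vandermonde_prod y * (mono even_monomial *
  mono (delta (pi1 N) - delta pi) * \prod_j y j) *
  (vandermonde_prod x * vandermonde_prod y)); last by ring.
by rewrite bb mul1r.
Qed.

End Comparison.

Theorem theorem2p3p2 (k : fieldType) (k_char0 : [pchar k] =i pred0)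
  (N : nat) (N_gt0 : (0 < N)%N)
  (pi : 'S_(N + N)) (pi_shuffle : is_shuffle pi)
  (R : realType) (a : 'I_(N + N) -> R * R)
  (a_clockwise : clockwise a) (a_general : general_position a) :
  (forall lam : 'rV[int]_(N + N),
     euler_char k pi lam =
     \sum_(phi : 'S_N) I_ind a pi phi (lam - delta (pi1 N) + delta pi)) /\
  (forall lam : 'rV[int]_(N + N),
     let c := \sum_(phi : 'S_N) I_ind a pi phi (lam - delta (pi1 N) + delta pi)
     in c = 0 \/ c = 1 \/ c = -1).
Proof.
have two_neq0 : 2 != 0 :> k by rewrite ((pcharf0P k).1 k_char0).
have sumE mu : \sum_(phi : 'S_N) I_ind a pi phi mu =
    (-1) ^+ (num_pairs N + num_inverted pi) * sector_sum pi mu.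
  rewrite /sector_sum mulr_sumr; apply: eq_bigr => phi _.
  rewrite /I_ind signed_sectorE; case: asboolP => _; last by rewrite !mulr0.
  rewrite crossing_sign // pair_signE inverted_signE exprD.
  by rewrite !mulrA.
split=> lam; first by rewrite sumE euler_char_sector_sum.
rewrite sumE /=; set d := _ * _.
have : (`|d| <= 1)%N.
  by rewrite /d abszM abszX exp1n mul1n; apply: signed_sector_sum_le1.
by move: d => d; lia.
Qed.
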